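(* Let $C_1,C_2,C_3\subset GL(4,{\bf C})$ be the conjugacy classes of diagonalizable matrices with eigenvalues respectively $(a,a,b,c)$, $(f,f,g,h)$, $(u,u,v,w)$, where $a,b,c$ (resp. $f,g,h$; resp. $u,v,w$) are distinct nonzero complex numbers with $a^2bc\,f^2gh\,u^2vw=1$, and suppose that the eigenvalues satisfy the only non-genericity relation $abfguv=1$ (in the sense of the context). Let ${\cal V}=\{(M_1,M_2,M_3)~|~M_j\in C_j,~M_1M_2M_3=I\}$. Then ${\cal V}$ contains at the same time triples with trivial centralizer and triples with non-trivial centralizer, and the dimension of ${\cal V}$ is the expected one, $\dim C_1+\dim C_2+\dim C_3-4^2+1=15$.
   Context: Denote by $\sigma_{k,j}$, $k=1,\ldots,4$, the eigenvalues of $C_j$ repeated with multiplicity. A non-genericity relation is an equality $\prod_{j=1}^{3}\prod_{k\in\Phi_j}\sigma_{k,j}=1$ where $\Phi_1,\Phi_2,\Phi_3\subset\{1,2,3,4\}$ have one and the same cardinality $m$, $1\le m<4$. ''The only non-genericity relation is $abfguv=1$'' means that this relation holds (hence so does the complementary one $acfhuw=1$, because the product of all eigenvalues is $1$) and no non-genericity relation other than these two holds. The centralizer of a triple is the set of matrices commuting with all three matrices; it is trivial if it consists only of scalar matrices. Dimensions are complex dimensions. *)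

(* Defs.v *)
From HB Require Import structures.
From mathcomp Require Import all_boot all_order all_algebra.
From mathcomp Require Import classical_sets reals.
From mathcomp Require Import complex mpoly.
Set Implicit Arguments.
Unset Strict Implicit.
Unset Printing Implicit Defensive.
Import Order.TTheory GRing.Theory Num.Theory.
Local Open Scope classical_set_scope.
Local Open Scope ring_scope.

(* Zariski topology and Krull dimension of subsets of a finite-dimensional
   vector space W, whose points are given coordinates by [v2r].  The choice
   of linear coordinates affects neither the closed sets nor the dimension. *)
Section Zariski.
Variables (F : fieldType) (W : vectType F).
Implicit Types (X Y Z : set W).

Definition zariski_closed Z : Prop :=
  exists I : set {mpoly F[dim W]},
    Z = [set x | forall p, I p -> p.@[fun i => VectorInternalTheory.v2r x 0 i] = 0].

Definition zariski_closed_in X Y : Prop :=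
  exists2 Z, zariski_closed Z & Y = X `&` Z.

Definition zariski_irreducible Y : Prop :=
  Y !=set0 /\
  forall Z1 Z2, zariski_closed Z1 -> zariski_closed Z2 ->
    Y `<=` Z1 `|` Z2 -> Y `<=` Z1 \/ Y `<=` Z2.

(* There are irreducible closed subsets Y 0 < Y 1 < ... < Y d of X. *)
Definition irreducible_chain X (d : nat) : Prop :=
  exists Y : nat -> set W,
    (forall i, (i <= d)%N ->
       zariski_closed_in X (Y i) /\ zariski_irreducible (Y i)) /\
    (forall i, (i < d)%N -> Y i `<` Y i.+1).

Definition has_dim X (d : nat) : Prop :=
  irreducible_chain X d /\
  (forall e, irreducible_chain X e -> (e <= d)%N).

End Zariski.

Section Triples.
Variable F : fieldType.

(* The eigenvalues, with multiplicity, of a class with one double eigenvalue. *)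
Definition spectrum (x y z : F) : 'rV[F]_4 :=
  \row_k [:: x; x; y; z]`_k.

(* Conjugacy class in GL(4, F) of the diagonal matrix with spectrum s. *)
Definition conj_class (s : 'rV[F]_4) : set 'M[F]_4 :=
  [set M | exists2 P, P \in unitmx & M = P *m diag_mx s *m invmx P].

Definition nongenericity (s1 s2 s3 : 'rV[F]_4) (A1 A2 A3 : {set 'I_4}) : Prop :=
  exists m : nat,
    [/\ (1 <= m < 4)%N,
        [/\ #|A1| = m, #|A2| = m & #|A3| = m] &
        (\prod_(k in A1) s1 0 k) * (\prod_(k in A2) s2 0 k) *
        (\prod_(k in A3) s3 0 k) = 1].

(* The multiset of eigenvalues selected by A.  Index sets selecting the same
   multisets give the same relation: as the first two entries of a spectrum
   coincide, each relation may arise from several triples of index sets. *)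
Definition selected (s : 'rV[F]_4) (A : {set 'I_4}) : seq F :=
  [seq s 0 k | k <- enum A].

Definition solutions (C1 C2 C3 : set 'M[F]_4) :
    set ('M[F]_4 * 'M[F]_4 * 'M[F]_4) :=
  [set T | [/\ C1 T.1.1, C2 T.1.2, C3 T.2 & T.1.1 *m T.1.2 *m T.2 = 1%:M]].

Definition centralizer (T : 'M[F]_4 * 'M[F]_4 * 'M[F]_4) : set 'M[F]_4 :=
  [set X | [/\ comm_mx X T.1.1, comm_mx X T.1.2 & comm_mx X T.2]].

Definition trivial_centralizer (T : 'M[F]_4 * 'M[F]_4 * 'M[F]_4) : Prop :=
  forall X, centralizer T X -> is_scalar_mx X.

End Triples.

(* Main.v *)
Require Import Defs.
From HB Require Import structures.
From mathcomp Require Import all_boot all_order all_algebra.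
From mathcomp Require Import classical_sets reals boolp.
From mathcomp Require Import complex mpoly.
From mathcomp Require Import perm ring.
Set Implicit Arguments.
Unset Strict Implicit.
Unset Printing Implicit Defensive.
Import Order.TTheory GRing.Theory Num.Theory VectorInternalTheory.
Local Open Scope classical_set_scope.
Local Open Scope ring_scope.

(* Two facts describe V.  First, Scott's lemma: if the rank sum of the operators
   X |-> M_j X - X N_j is below 2mn, there is a nonzero intertwiner between the
   triples M and N, in one direction or the other.  Let A and B be the triples of
   2 x 2 matrices with eigenvalues (a,b), (f,g), (u,v) and (a,c), (f,h), (u,w);
   the absence of further non-genericity relations makes them irreducible.  The
   lemma applies to A and any solution (15 < 16), so that every solution is an
   extension of A by B or of B by A, and to any two solutions (30 < 32), so that
   nonsplit extensions of the same kind are conjugate.  A count of dimensions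
   (9 > 8) yields nonsplit extensions, whose centralizer is trivial.  Hence V is
   the union of three orbits of GL(4), that of the direct sum of A and B having a
   non-trivial centralizer.

   Secondly, dimensions of orbits.  A chain of e+1 irreducible closed sets gives e
   algebraically independent functions, and there are at most k such functions on
   a set parametrized rationally by k variables.  Almost every P in GL(4) can be
   normalized, modulo the centralizer, into an affine space through 1 whose
   dimension k is the codimension of the centralizer, which bounds the dimension
   of the orbit by k.  Conversely the closures of the images of a flag in that
   affine space are distinct, because the differential of P |-> P T P^-1 at 1 is
   injective there. *)

(** * Algebraic dependence *)

Section MpolyEval.

Lemma meval_muni n (R : comNzRingType) (p : {mpoly R[n.+1]}) (x : 'I_n.+1 -> R) :
  p.@[x] = (map_poly (meval (fun i : 'I_n => x (widen_ord (leqnSn n) i))) (muni p)).[x ord_max].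
Proof.
rewrite muniE raddf_sum /= horner_sum mevalE; apply: eq_bigr => m _.
rewrite map_polyZ /= map_polyXn hornerZ hornerXn mevalZ mevalX.
rewrite -!mulrA; congr (_ * _).
by rewrite big_ord_recr /=; congr (_ * _); apply: eq_bigr => i _; rewrite mnmE.
Qed.

(** Distinct monomials of [p] contribute to distinct coefficients of [muni p], so nothing can
    cancel. *)
Lemma muni_eq0 n (R : nzRingType) (p : {mpoly R[n.+1]}) : muni p = 0 -> p = 0.
Proof.
move=> p0; apply/eqP; rewrite -msupp_eq0; apply/eqP.
case Es: (msupp p) => [//|m s]; exfalso.
have ms : m \in msupp p by rewrite Es mem_head.
have := congr1 (fun q : {poly {mpoly R[n]}} =>
  (q`_(m ord_max))@_[multinom m (widen_ord (leqnSn n) i) | i < n]) p0.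
rewrite muniE coef_sum coef0 mcoeff0 raddf_sum /= (bigD1_seq m) ?msupp_uniq //=.
rewrite coefZ coefXn eqxx mulr1 mcoeffZ mcoeffX eqxx mulr1.
rewrite big1 ?addr0 => [|k km].
  by move/eqP; rewrite mcoeff_eq0 ms.
rewrite coefZ coefXn.
case: eqP => [ek|_]; rewrite ?mulr0 ?mcoeff0 // mulr1 mcoeffZ mcoeffX.
case: eqP => [e|_]; rewrite ?mulr0 //; case/eqP: km.
apply/mnmP => i; case: (unliftP ord_max i) => [j ->|-> //].
have := congr1 (fun u : 'X_{1..n} => u j) e; rewrite !mnmE.
have -> // : widen_ord (leqnSn n) j = lift ord_max j.
by apply: val_inj; rewrite /= /bump leqNgt ltn_ord.
Qed.

Variable F : numFieldType.

Lemma poly_eval0 (p : {poly F}) : (forall t, p.[t] = 0) -> p = 0.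
Proof.
move=> p0; apply/eqP/negPn/negP => pn0.
(* In characteristic 0 these [size p] integers are distinct, which is one root too many. *)
pose s := [seq (i%:R : F) | i <- iota 0 (size p)].
have us : uniq s by rewrite map_inj_uniq ?iota_uniq // => i j /eqP; rewrite eqr_nat => /eqP.
have rs : all (root p) s by apply/allP => t _; rewrite /root p0.
by have := max_poly_roots pn0 rs us; rewrite size_map size_iota ltnn.
Qed.

Lemma mpoly_eval0 n (p : {mpoly F[n]}) : (forall x, p.@[x] = 0) -> p = 0.
Proof.
elim: n p => [|n IHn] p p0.
  have := p0 (fun=> 0); rewrite (nvar0_mpolyC p) mevalC => ->; exact: mpolyC0.
apply: muni_eq0; apply/polyP => k; rewrite coef0; apply: IHn => y.
pose q := map_poly (meval y) (muni p).
suff q0 : q = 0 by rewrite -(coef_map (meval y)) -/q q0 coef0.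
apply: poly_eval0 => t.
pose x (i : 'I_n.+1) := if unlift ord_max i is Some j then y j else t.
have := p0 x; rewrite meval_muni /q => <-.
have -> : x ord_max = t by rewrite /x unlift_none.
congr (_.[_]); apply: eq_map_poly => r; apply: meval_eq => i; rewrite /x.
have -> : widen_ord (leqnSn n) i = lift ord_max i.
  by apply: val_inj; rewrite /= /bump leqNgt ltn_ord.
by rewrite liftK.
Qed.

Lemma mpoly_neq0_eval n (p : {mpoly F[n]}) : p != 0 -> exists x, p.@[x] != 0.
Proof.
move=> pn0; apply: contrapT => h; case/eqP: pn0; apply: mpoly_eval0 => x.
by apply/eqP/negPn/negP => hx; apply: h; exists x.
Qed.

End MpolyEval.

Section AlgebraicDependence.
Variable F : numFieldType.

Lemma msizeM_leS n (p q : {mpoly F[n]}) a b :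
  (msize p <= a.+1 -> msize q <= b.+1 -> msize (p * q) <= (a + b).+1)%N.
Proof.
move=> pa qb; have [->|p0] := eqVneq p 0; first by rewrite mul0r msize0.
have [->|q0] := eqVneq q 0; first by rewrite mulr0 msize0.
rewrite msizeM //; have := leq_add pa qb; rewrite addSn addnS.
by case: (_ + _)%N => //= k; rewrite !ltnS.
Qed.

Lemma msizeX_leS n (p : {mpoly F[n]}) a e :
  (msize p <= a.+1 -> msize (p ^+ e) <= (e * a).+1)%N.
Proof.
move=> pa; elim: e => [|e IHe]; first by rewrite expr0 msize1.
by rewrite exprS mulSn; apply: msizeM_leS.
Qed.

Lemma msize_prod_leS n k (p : 'I_k -> {mpoly F[n]}) a :
  (forall i, msize (p i) <= a.+1)%N -> (msize (\prod_i p i) <= (k * a).+1)%N.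
Proof.
elim: k p => [|k IHk] p pa; first by rewrite big_ord0 msize1.
by rewrite big_ord_recl mulSn; apply: msizeM_leS => //; apply: IHk.
Qed.

Lemma card_bmultinom n b : (#|{: 'X_{1..n < b}}| <= b ^ n)%N.
Proof.
have lt (m : 'X_{1..n < b}) i : (m i < b)%N.
  by apply: leq_ltn_trans (bmdeg m); rewrite mdegE (bigD1 i) //= leq_addr.
pose f (m : 'X_{1..n < b}) := [ffun i => Ordinal (lt m i)].
have fI : injective f.
  move=> m1 m2 /ffunP e; apply: val_inj; apply/mnmP => i.
  by have := congr1 val (e i); rewrite !ffunE.
have <- : #|{ffun 'I_n -> 'I_b}| = (b ^ n)%N by rewrite card_ffun !card_ord.
exact: leq_card fI.
Qed.

(** The coefficient matrix [A] has at most [b ^ n] columns, one per monomial of degree below [b],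
    hence fewer columns than rows. *)
Lemma mpoly_lin_dep n (I : finType) (b : nat) (g : I -> {mpoly F[n]}) :
  (forall i, msize (g i) <= b)%N -> (b ^ n < #|I|)%N ->
  exists2 c : I -> F, (exists i, c i != 0) & \sum_i c i *: g i = 0.
Proof.
move=> gb lt.
pose A := \matrix_(i < #|I|, j < #|{: 'X_{1..n < b}}|)
  (g (enum_val i))@_(enum_val j : 'X_{1..n < b}).
have: kermx A != 0.
  rewrite kermx_eq0 /row_free neq_ltn (leq_ltn_trans (rank_leq_col _)) //.
  exact: leq_ltn_trans (card_bmultinom n b) lt.
case/rowV0Pn => u /sub_kermxP uA un0.
exists (fun i => u 0 (enum_rank i)).
  case/rV0Pn: un0 => j uj; exists (enum_val j); by rewrite enum_valK.
apply/mpolyP => m; rewrite mcoeff0 raddf_sum /=.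
case: (ltnP (mdeg m) b) => mb.
  have := congr1 (fun B : 'rV_ _ => B 0 (enum_rank (BMultinom mb))) uA.
  rewrite mxE [RHS]mxE => uA0; rewrite -{}[RHS]uA0.
  rewrite [RHS](reindex (@enum_rank I)) /=; last first.
    exact/onW_bij/enum_rank_bij.
  apply: eq_bigr => i _; by rewrite mcoeffZ mxE !enum_rankK.
rewrite big1 // => i _; rewrite mcoeffZ memN_msupp_eq0 ?mulr0 //.
exact/msize_mdeg_ge/(leq_trans (gb i)).
Qed.

(* Nothing is required of y at the points where d vanishes. *)
Definition ratfun k (d : {mpoly F[k]}) (y : ('I_k -> F) -> F) :=
  exists N (q : {mpoly F[k]}), forall x, d.@[x] != 0 -> y x * d.@[x] ^+ N = q.@[x].

(* Over a common denominator, the D^(k+1) monomials in the y j with all exponents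
   below D become polynomials of degree O(D) in k variables, which span a space
   of dimension O(D^k). *)
Lemma ratfun_alg_dep k d (y : 'I_k.+1 -> ('I_k -> F) -> F) :
  (forall j, ratfun d (y j)) ->
  exists2 Q : {mpoly F[k.+1]}, Q != 0 &
    forall x, d.@[x] != 0 -> Q.@[fun j => y j x] = 0.
Proof.
move=> /choice[N /choice[q yq]].
pose q1 j := q j * d ^+ (\max_i N i - N j).
have {}yq j x : d.@[x] != 0 -> y j x * d.@[x] ^+ (\max_i N i) = (q1 j).@[x].
  move=> dx; rewrite /q1 mevalM rmorphXn /= -yq // -mulrA -exprD subnKC //.
  exact: leq_bigmax.
move: (\max_i _) q1 yq => {N q} N q yq.
pose dN := d ^+ N.
pose M := maxn (msize dN) (\max_j msize (q j)).
have dM : (msize dN <= M.+1)%N by apply: leqW; apply: leq_maxl.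
have qM j : (msize (q j) <= M.+1)%N.
  by apply: leqW; apply: leq_trans (leq_maxr _ _); apply: leq_bigmax.
(* Each [g e] has size at most [C * D], and [D > C ^ k] gives [(C * D) ^ k < D ^ k.+1 = #|E|], as
   [mpoly_lin_dep] requires. *)
pose C := (k.+1 * M).+1; pose D := (C ^ k).+1.
pose E := {ffun 'I_k.+1 -> 'I_D}.
pose g (e : E) := \prod_j (q j ^+ e j * dN ^+ (D - e j)).
have gb e : (msize (g e) <= C * D)%N.
  apply: (@leq_trans (k.+1 * (D * M)).+1).
    apply: msize_prod_leS => j.
    have -> : (D * M = e j * M + (D - e j) * M)%N.
      by rewrite -mulnDl subnKC // ltnW.
    by apply: msizeM_leS; apply: msizeX_leS.
  by rewrite /C [leqRHS]mulSn -mulnA (mulnC M D) addnC -addn1 leq_add2l.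
have := mpoly_lin_dep gb; case.
  by rewrite card_ffun !card_ord expnS expnMn ltn_pmul2r ?expn_gt0.
move=> c [e0 ce0] c0.
pose mn (e : E) := [multinom (e j : nat) | j < k.+1].
have mnI : injective mn.
  move=> e1 e2 /mnmP h; apply/ffunP => j; apply: val_inj.
  by have := h j; rewrite !mnmE.
exists (\sum_e c e *: 'X_[mn e]).
  apply/eqP => /(congr1 (mcoeff (mn e0))).
  rewrite mcoeff0 raddf_sum /= (bigD1 e0) //= mcoeffZ mcoeffX eqxx mulr1.
  rewrite big1 ?addr0; first by move/eqP; rewrite (negPf ce0).
  by move=> e ne; rewrite mcoeffZ mcoeffX (inj_eq mnI) (negPf ne) mulr0.
move=> x dx; have dN0 : dN.@[x] != 0 by rewrite rmorphXn expf_neq0.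
(* Multiplying by this nonzero factor clears all denominators and turns the claim into the linear
   relation [c0]. *)
apply: (mulIf (expf_neq0 k.+1 (expf_neq0 D dN0))).
rewrite mul0r -(meval0 x) -c0 !raddf_sum /= mulr_suml; apply: eq_bigr => e _.
rewrite !mevalZ -mulrA; congr (_ * _); rewrite mevalX rmorph_prod /=.
have -> : dN.@[x] ^+ D ^+ k.+1 = \prod_(j < k.+1) dN.@[x] ^+ D.
  by rewrite prodr_const card_ord.
rewrite -big_split /=.
apply: eq_bigr => j _; rewrite mnmE mevalM !rmorphXn /= -yq // -/dN -rmorphXn -/dN.
by rewrite exprMn -mulrA -exprD subnKC // ltnW.
Qed.
End AlgebraicDependence.

Section RationalFunctions.
Variables (F : numFieldType) (k : nat) (d : {mpoly F[k]}).
Implicit Types y z : ('I_k -> F) -> F.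

Lemma ratfunC c : ratfun d (fun=> c).
Proof. by exists 0%N, c%:MP => x _; rewrite expr0 mulr1 mevalC. Qed.

Lemma ratfunD y z : ratfun d y -> ratfun d z -> ratfun d (fun x => y x + z x).
Proof.
move=> [N [q yq]] [M [r zr]]; exists (N + M)%N, (q * d ^+ M + r * d ^+ N) => x dx.
by rewrite mevalD !mevalM !rmorphXn /= -yq // -zr // exprD; ring.
Qed.

Lemma ratfunM y z : ratfun d y -> ratfun d z -> ratfun d (fun x => y x * z x).
Proof.
move=> [N [q yq]] [M [r zr]]; exists (N + M)%N, (q * r) => x dx.
by rewrite mevalM -yq // -zr // mulrACA exprD.
Qed.

Lemma ratfun_sum (I : Type) (s : seq I) (y : I -> ('I_k -> F) -> F) :
  (forall i, ratfun d (y i)) -> ratfun d (fun x => \sum_(i <- s) y i x).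
Proof.
move=> h; elim: s => [|i s IHs].
  have -> : (fun x => \sum_(i <- [::]) y i x) = fun=> 0 by apply/funext => x; rewrite big_nil.
  exact: ratfunC.
have -> : (fun x => \sum_(j <- i :: s) y j x) = fun x => y i x + \sum_(j <- s) y j x.
  by apply/funext => x; rewrite big_cons.
exact: ratfunD.
Qed.

Lemma ratfun_prod (I : Type) (s : seq I) (y : I -> ('I_k -> F) -> F) :
  (forall i, ratfun d (y i)) -> ratfun d (fun x => \prod_(i <- s) y i x).
Proof.
move=> h; elim: s => [|i s IHs].
  have -> : (fun x => \prod_(i <- [::]) y i x) = fun=> 1 by apply/funext => x; rewrite big_nil.
  exact: ratfunC.
have -> : (fun x => \prod_(j <- i :: s) y j x) = fun x => y i x * \prod_(j <- s) y j x.
  by apply/funext => x; rewrite big_cons.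
exact: ratfunM.
Qed.

Lemma ratfunX y n : ratfun d y -> ratfun d (fun x => y x ^+ n).
Proof.
move=> yr; elim: n => [|n IHn]; first exact: (ratfunC 1).
have -> : (fun x => y x ^+ n.+1) = fun x => y x * y x ^+ n.
  by apply/funext => x; rewrite exprS.
exact: ratfunM.
Qed.

Lemma ratfun_meval n (p : {mpoly F[n]}) (y : 'I_n -> ('I_k -> F) -> F) :
  (forall i, ratfun d (y i)) -> ratfun d (fun x => p.@[fun i => y i x]).
Proof.
move=> h; have -> : (fun x => p.@[fun i => y i x]) =
    fun x => \sum_(m <- msupp p) p@_m * \prod_i y i x ^+ m i.
  by apply/funext => x; rewrite mevalE.
apply: ratfun_sum => m; apply: ratfunM; first exact: ratfunC.
by apply: ratfun_prod => i; apply: ratfunX.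
Qed.

End RationalFunctions.

(** * Chains of irreducible closed sets *)

Section ZariskiSets.
Variables (F : numFieldType) (W : vectType F).
Implicit Types (X Y Z : set W) (p q : {mpoly F[dim W]}).

Definition pev p (x : W) : F := p.@[fun i => v2r x 0 i].

Lemma pev_meval n (Q : {mpoly F[n]}) (p : 'I_n -> {mpoly F[dim W]}) x :
  pev (Q \mPo [tuple p i | i < n]) x = Q.@[fun i => pev (p i) x].
Proof.
by rewrite /pev comp_mpoly_meval; apply: meval_eq => i; rewrite tnth_mktuple.
Qed.

Lemma zariski_closed_zeros p : zariski_closed [set x | pev p x = 0].
Proof.
exists [set p]; apply/seteqP; split => x /=; first by move=> px q ->.
by apply.
Qed.

Lemma irreducible_mulf_eq0 Y p q : zariski_irreducible Y ->
  (forall x, Y x -> pev p x * pev q x = 0) ->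
  (forall x, Y x -> pev p x = 0) \/ (forall x, Y x -> pev q x = 0).
Proof.
move=> [_ irr] pq.
apply: (irr [set x | pev p x = 0] [set x | pev q x = 0]).
- exact: zariski_closed_zeros.
- exact: zariski_closed_zeros.
- by move=> x /pq /eqP; rewrite mulf_eq0 => /orP[] /eqP; [left|right].
Qed.

(* On Y e the last function p e vanishes, so by induction the constant coefficient
   of a relation, as a polynomial in p e, is zero; as Y e.+1 is irreducible, the
   relation can then be divided by p e. *)
Lemma chain_alg_indep e (Y : nat -> set W) (p : nat -> {mpoly F[dim W]}) :
  (forall i, (i <= e)%N -> zariski_irreducible (Y i)) ->
  (forall i, (i < e)%N -> [/\ Y i `<=` Y i.+1, forall x, Y i x -> pev (p i) x = 0 &
     exists2 x, Y i.+1 x & pev (p i) x != 0]) ->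
  forall Q : {mpoly F[e]}, (forall x, Y e x -> Q.@[fun i => pev (p i) x] = 0) -> Q = 0.
Proof.
elim: e => [|e IHe] irr sep Q Q0.
  case: (irr 0%N isT) => -[x Yx] _; have := Q0 x Yx.
  by rewrite (nvar0_mpolyC Q) mevalC => ->; exact: mpolyC0.
have {}IHe (r : {mpoly F[e]}) : (forall x, Y e x -> r.@[fun i => pev (p i) x] = 0) -> r = 0.
  apply: IHe => [i ie|i ie]; first by apply: irr; apply: leqW.
  by apply: sep; apply: leqW.
case: (sep e (ltnSn e)) => sub p0 [x1 Yx1 px1].
pose T (x : W) := meval (fun i : 'I_e => pev (p i) x).
suff key (r : {poly {mpoly F[e]}}) :
    (forall x, Y e.+1 x -> (map_poly (T x) r).[pev (p e) x] = 0) -> r = 0.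
  apply: muni_eq0; apply: key => x Yx; have := Q0 x Yx; rewrite meval_muni.
  by [].
elim/poly_ind: r => [//|r c IHr] r0.
have ev x : (map_poly (T x) (r * 'X + c%:P)).[pev (p e) x] =
    (map_poly (T x) r).[pev (p e) x] * pev (p e) x + T x c.
  by rewrite rmorphD rmorphM /= map_polyX map_polyC hornerD hornerMX hornerC.
have c0 : c = 0.
  apply: IHe => x Yx; have := r0 x (sub x Yx).
  by rewrite ev p0 // mulr0 add0r.
rewrite c0 polyC0 addr0.
suff -> : r = 0 by rewrite mul0r.
apply: IHr.
(* [q] is the quotient of the relation by [p e], pulled back to a polynomial on [W] so that
   irreducibility applies to it. *)
pose q := (map_poly (comp_mpoly [tuple p i | i < e]) r).[p e].
have qE x : pev q x = (map_poly (T x) r).[pev (p e) x].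
  rewrite /pev /q -horner_map -map_poly_comp; congr (_.[_]).
  by apply: eq_map_poly => s /=; exact: pev_meval.
case: (@irreducible_mulf_eq0 (Y e.+1) q (p e)).
- exact: irr.
- by move=> x Yx; have := r0 x Yx; rewrite ev c0 /T meval0 addr0 qE.
- by move=> q0 x Yx; rewrite -qE q0.
- by move=> /(_ x1 Yx1) /eqP; rewrite (negPf px1).
Qed.

(** The Zariski closure. *)
Definition zcl Y : set W :=
  [set x | forall p, (forall y, Y y -> pev p y = 0) -> pev p x = 0].

Lemma zariski_closed_zcl Y : zariski_closed (zcl Y).
Proof. by exists [set p | forall y, Y y -> pev p y = 0]. Qed.

Lemma sub_zcl Y : Y `<=` zcl Y.
Proof. by move=> x Yx p; apply. Qed.

Lemma zcl_min Y Z : zariski_closed Z -> Y `<=` Z -> zcl Y `<=` Z.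
Proof. by move=> [I ->] YZ x Yx p Ip; apply: Yx => y Yy; apply: YZ. Qed.

Lemma zclS Y Z : Y `<=` Z -> zcl Y `<=` zcl Z.
Proof. by move=> YZ; apply: zcl_min (zariski_closed_zcl _) _ => x /YZ /sub_zcl. Qed.

Lemma irreducible_zcl X Y : Y `<=` X -> zariski_irreducible Y ->
  zariski_irreducible (X `&` zcl Y).
Proof.
move=> YX [[x Yx] irr]; split; first by exists x; split; [exact: YX|exact: sub_zcl].
move=> Z1 Z2 c1 c2 sub; case: (irr Z1 Z2 c1 c2).
- by move=> y Yy; apply: sub; split; [exact: YX|exact: sub_zcl].
- by move=> h; left => y [_]; apply: zcl_min.
- by move=> h; right => y [_]; apply: zcl_min.
Qed.

Definition ratmap k (d : {mpoly F[k]}) (f : ('I_k -> F) -> W) :=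
  forall i, ratfun d (fun x => v2r (f x) 0 i).

Lemma ratfun_pev k d (f : ('I_k -> F) -> W) p : ratmap d f -> ratfun d (fun x => pev p (f x)).
Proof. by move=> fr; apply: ratfun_meval. Qed.

(** Zeros of [d] are excluded because [ratmap] does not control [f] there. *)
Definition ratimage k (d : {mpoly F[k]}) (f : ('I_k -> F) -> W) : set W :=
  [set y | exists2 x, d.@[x] != 0 & y = f x].

(** If [p1] and [p2] witness that neither closed set contains the image, their numerators [q1], [q2]
    are nonzero polynomials; where [d * q1 * q2] does not vanish, the image point lies in neither
    set. *)
Lemma irreducible_ratimage k d (f : ('I_k -> F) -> W) :
  d != 0 -> ratmap d f -> zariski_irreducible (ratimage d f).
Proof.
move=> d0 fr; split.
  by case: (mpoly_neq0_eval d0) => x dx; exists (f x), x.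
move=> Z1 Z2 [I1 ->] [I2 ->] sub; apply: contrapT => /not_orP[].
move=> /existsNP[_ /not_implyP[[x1 dx1 ->]]] /existsNP[p1 /not_implyP[Ip1 p1x1]].
move=> /existsNP[_ /not_implyP[[x2 dx2 ->]]] /existsNP[p2 /not_implyP[Ip2 p2x2]].
case: (ratfun_pev p1 fr) => N1 [q1 e1]; case: (ratfun_pev p2 fr) => N2 [q2 e2].
have q10 : q1 != 0.
  apply: contra_notN p1x1 => /eqP q0; have /eqP := e1 x1 dx1.
  by rewrite q0 meval0 mulf_eq0 expf_eq0 (negPf dx1) andbF orbF => /eqP.
have q20 : q2 != 0.
  apply: contra_notN p2x2 => /eqP q0; have /eqP := e2 x2 dx2.
  by rewrite q0 meval0 mulf_eq0 expf_eq0 (negPf dx2) andbF orbF => /eqP.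
have [x] := mpoly_neq0_eval (mulf_neq0 d0 (mulf_neq0 q10 q20)).
rewrite !mevalM !mulf_eq0 !negb_or => /and3P[dx q1x q2x].
case: (sub (f x)); first by exists x.
- by move=> /(_ _ Ip1) p0; move: q1x; rewrite -e1 // [pev _ _]p0 mul0r eqxx.
- by move=> /(_ _ Ip2) p0; move: q2x; rewrite -e2 // [pev _ _]p0 mul0r eqxx.
Qed.

Lemma ratimage_alg_dep k d (f : ('I_k -> F) -> W) (y : 'I_k.+1 -> {mpoly F[dim W]}) :
  ratmap d f -> exists2 Q : {mpoly F[k.+1]}, Q != 0 &
    forall x, zcl (ratimage d f) x -> Q.@[fun j => pev (y j) x] = 0.
Proof.
move=> fr; have [] := @ratfun_alg_dep F k d (fun j x => pev (y j) (f x)).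
  by move=> j; apply: ratfun_pev.
move=> Q Q0 QE; exists Q => // x; rewrite -pev_meval; apply => _ [t dt ->].
by rewrite pev_meval QE.
Qed.

(** A chain longer than [k] yields [k.+1] functions [p i], vanishing on [Y i] but not on [Y i.+1],
    which are independent on [Y k.+1]. They satisfy a relation on each of the finitely many pieces,
    and the product of these relations holds on all of [X]. *)
Lemma chain_bound X k (r : nat) (d : 'I_r -> {mpoly F[k]}) (f : 'I_r -> ('I_k -> F) -> W) :
  (forall i, ratmap (d i) (f i)) ->
  (forall x, X x -> exists i, zcl (ratimage (d i) (f i)) x) ->
  forall e, irreducible_chain X e -> (e <= k)%N.
Proof.
move=> fr cov e [Y [Yirr Ystr]]; rewrite leqNgt; apply/negP => ke.
have sep i : exists p, (i < e)%N -> (forall x, Y i x -> pev p x = 0) /\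
    exists2 x, Y i.+1 x & pev p x != 0.
  have [ie|_] := boolP (i < e)%N; last by exists 0.
  have [sub /existsNP[x /not_implyP[Yx nYx]]] := Ystr i ie.
  have [[Z [I ->] YE] _] := Yirr i (ltnW ie).
  have [[Z' _ Y'E] _] := Yirr i.+1 ie.
  have Xx : X x by move: Yx; rewrite Y'E => -[].
  have /existsNP[p /not_implyP[Ip px]] : ~ (forall p, I p -> pev p x = 0).
    by move=> h; apply: nYx; rewrite YE.
  exists p => _; split; last by exists x => //; apply/eqP.
  by move=> z; rewrite YE => -[_]; apply.
move/choice: sep => [p sep].
have [Q Q0 QE] : exists2 Q : {mpoly F[k.+1]}, Q != 0 &
    forall x, X x -> Q.@[fun j : 'I_k.+1 => pev (p j) x] = 0.
  have : forall i, exists Q : {mpoly F[k.+1]}, Q != 0 /\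
      forall x, zcl (ratimage (d i) (f i)) x -> Q.@[fun j : 'I_k.+1 => pev (p j) x] = 0.
    by move=> i; have [Q] := ratimage_alg_dep (fun j : 'I_k.+1 => p j) (fr i); exists Q.
  move=> /choice[Q QE]; exists (\prod_i Q i).
    by apply/prodf_neq0 => i _; case: (QE i).
  move=> x /cov[i xi]; rewrite rmorph_prod /= (bigD1 i) //= (proj2 (QE i)) //.
  by rewrite mul0r.
case/eqP: Q0; apply: (@chain_alg_indep k.+1 Y p) => [i ik|i ik|x Yx].
- by case: (Yirr i (leq_trans ik ke)).
- have ie := leq_trans ik ke; have [h1 h2] := sep i ie; split=> //.
  by case: (Ystr i ie).
- apply: QE; have [[Z _ YE] _] := Yirr k.+1 ke; by move: Yx; rewrite YE => -[].
Qed.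

End ZariskiSets.

(** * Dimension of a finite union of orbits *)

Section LinearFormula.
Variables (F : fieldType) (V : lmodType F) (m n : nat).

Lemma linear_matrix_sum (L : 'M[F]_(m, n) -> V) (A : 'M[F]_(m, n)) : linear L ->
  L A = \sum_i \sum_j A i j *: L (delta_mx i j).
Proof.
move=> Llin; have L0 : L 0 = 0.
  by have := Llin (-1) 0 0; rewrite scaler0 addr0 scaleN1r addNr.
have LD : {morph L : x y / x + y} by move=> x y; have := Llin 1 x y; rewrite !scale1r.
rewrite {1}[A]matrix_sum_delta (big_morph L LD L0); apply: eq_bigr => i _.
rewrite (big_morph L LD L0); apply: eq_bigr => j _.
by have := Llin (A i j) (delta_mx i j) 0; rewrite !addr0 L0 addr0.
Qed.
End LinearFormula.

Section OrbitMaps.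
Variables (F : numFieldType) (n : nat).
Implicit Types (E : nat -> 'M[F]_n) (A : 'M[F]_n).

Definition affine_mx E k (x : 'I_k -> F) : 'M[F]_n := 1%:M + \sum_i x i *: E i.

(** The generic member of the family: its determinant and adjugate are polynomial and specialize to
    those of [affine_mx]. *)
Definition affine_mpoly_mx E k : 'M[{mpoly F[k]}]_n :=
  1%:M + \sum_i 'X_i *: map_mx (@mpolyC k F) (E i).

Lemma meval_affine_mx E k (x : 'I_k -> F) :
  map_mx (meval x) (affine_mpoly_mx E k) = affine_mx E x.
Proof.
apply/matrixP => i j; rewrite !mxE mevalD !summxE raddf_sum /= rmorph_nat; congr (_ + _).
by apply: eq_bigr => l _; rewrite !mxE mevalM mevalXU mevalC.
Qed.

Definition det_affine E k : {mpoly F[k]} := \det (affine_mpoly_mx E k).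

Lemma meval_det_affine E k (x : 'I_k -> F) : (det_affine E k).@[x] = \det (affine_mx E x).
Proof. by rewrite /det_affine -det_map_mx meval_affine_mx. Qed.

Lemma det_affine_neq0 E k : det_affine E k != 0.
Proof.
have := meval_det_affine E (fun _ : 'I_k => 0).
rewrite /affine_mx big1 ?addr0 ?det1 => [h|i _]; last by rewrite scale0r.
by apply: contra_eq_neq h => ->; rewrite meval0 eq_sym oner_eq0.
Qed.

Lemma meval_adj_affine E k (x : 'I_k -> F) :
  map_mx (meval x) (\adj (affine_mpoly_mx E k)) = \adj (affine_mx E x).
Proof. by rewrite map_mx_adj meval_affine_mx. Qed.

Lemma invmx_adj A : \det A != 0 -> invmx A = (\det A)^-1 *: \adj A.
Proof. by move=> d0; rewrite /invmx unitmxE unitfE d0. Qed.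

Lemma mpoly_linear k (L : 'M[F]_n -> F) (B : 'M[{mpoly F[k]}]_n) : linear (L : _ -> F^o) ->
  exists q : {mpoly F[k]}, forall x, q.@[x] = L (map_mx (meval x) B).
Proof.
move=> Llin; exists (\sum_i \sum_j L (delta_mx i j) *: B i j) => x.
rewrite (linear_matrix_sum (map_mx (meval x) B) Llin) raddf_sum /=.
apply: eq_bigr => i _; rewrite raddf_sum /=; apply: eq_bigr => j _.
by rewrite mevalZ mxE mulrC.
Qed.

Variable W : vectType F.
Implicit Type beta : 'M[F]_n -> 'M[F]_n -> W.

Definition bilinear_map beta := (forall Q, linear (beta^~ Q)) /\ (forall P, linear (beta P)).

(** The inverse is the adjugate over the determinant, so one power of [det_affine] is a common
    denominator. *)
Lemma ratmap_affine beta E k : bilinear_map beta ->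
  ratmap (det_affine E k) (fun x : 'I_k -> F => beta (affine_mx E x) (invmx (affine_mx E x))).
Proof.
move=> [bl br] l; pose c P Q := v2r (beta P Q) 0 l.
pose PP := affine_mpoly_mx E k.
have cr P : linear (c P : _ -> F^o).
  by move=> a Q Q'; rewrite /c br (linearP (@v2r _ W)) !mxE.
have cl Q : linear (c^~ Q : _ -> F^o).
  by move=> a P P'; rewrite /c bl (linearP (@v2r _ W)) !mxE.
have h i j : exists q : {mpoly F[k]}, forall x,
    q.@[x] = c (delta_mx i j) (\adj (affine_mx E x)).
  have [q qE] := mpoly_linear (\adj PP) (cr (delta_mx i j)).
  by exists q => x; rewrite qE meval_adj_affine.
have {}h i : exists q : 'I_n -> {mpoly F[k]}, forall j (x : 'I_k -> F),
    (q j).@[x] = c (delta_mx i j) (\adj (affine_mx E x)).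
  by have [q qE] := choice (h i); exists q.
have [q qE] := choice h.
exists 1%N, (\sum_i \sum_j PP i j * q i j) => x; rewrite meval_det_affine => d0.
rewrite expr1 invmx_adj // -/(c _ _).
have -> : c (affine_mx E x) ((\det (affine_mx E x))^-1 *: \adj (affine_mx E x)) =
    (\det (affine_mx E x))^-1 * c (affine_mx E x) (\adj (affine_mx E x)).
  have c0 P : c P 0 = 0.
    by have := cr P (-1) 0 0; rewrite scaler0 addr0 scaleN1r addNr.
  by have := cr (affine_mx E x) (\det (affine_mx E x))^-1 (\adj (affine_mx E x)) 0;
    rewrite c0 !addr0.
rewrite mulrAC mulVf // mul1r (linear_matrix_sum _ (cl _)) raddf_sum /=.
apply: eq_bigr => i _; rewrite raddf_sum /=; apply: eq_bigr => j _.
by rewrite mevalM qE -meval_affine_mx mxE.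
Qed.

(** Inserting [P] and its inverse into a bilinear map covers both conjugation of one matrix and
    simultaneous conjugation of a triple. *)
Definition orbit_of beta : set W :=
  [set w | exists2 P, P \in unitmx & w = beta P (invmx P)].

Definition affine_slice beta E k : set W :=
  ratimage (det_affine E k) (fun x : 'I_k -> F => beta (affine_mx E x) (invmx (affine_mx E x))).

Lemma affine_sliceP beta E k w :
  affine_slice beta E k w <->
  exists2 x : 'I_k -> F, affine_mx E x \in unitmx &
    w = beta (affine_mx E x) (invmx (affine_mx E x)).
Proof.
by split=> -[x dx ->]; exists x; rewrite // ?unitmxE ?unitfE in dx *;
  rewrite meval_det_affine in dx *.
Qed.

Lemma affine_slice_sub beta E k : affine_slice beta E k `<=` orbit_of beta.
Proof. by move=> w /affine_sliceP[x u ->]; exists (affine_mx E x). Qed.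

Lemma affine_sliceS beta E k : affine_slice beta E k `<=` affine_slice beta E k.+1.
Proof.
move=> w /affine_sliceP[x u ->]; apply/affine_sliceP.
pose x' (i : 'I_k.+1) := if unlift ord_max i is Some j then x j else 0.
have e : affine_mx E x' = affine_mx E x.
  rewrite /affine_mx big_ord_recr /= {2}/x' unlift_none scale0r addr0.
  congr (_ + _); apply: eq_bigr => i _; congr (_ *: _); rewrite /x'.
  have -> : widen_ord (leqnSn k) i = lift ord_max i.
    by apply: val_inj; rewrite /= /bump leqNgt ltn_ord.
  by rewrite liftK.
by exists x'; rewrite e.
Qed.

(* Almost every P in GL_n can be moved into the affine slice 1 + <E_0, ..., E_(k-1)>
   without changing the point P . w of the orbit. *)
Definition generic_slice beta E k :=
  exists delta : 'M[F]_n -> F,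
    [/\ delta 1%:M != 0,
        forall A, exists q : {mpoly F[1]}, forall x, q.@[x] = delta (affine_mx (fun=> A) x) &
        forall P, P \in unitmx -> delta P != 0 -> affine_slice beta E k (beta P (invmx P))].

(* Join P to the identity by a line: a polynomial vanishing on the slice vanishes
   at almost all points of the line, hence at P. *)
Lemma orbit_sub_zcl_slice beta E k : bilinear_map beta -> generic_slice beta E k ->
  orbit_of beta `<=` zcl (affine_slice beta E k).
Proof.
move=> bb [delta [d1 dpoly dslice]] _ [P uP ->] p p0; apply: contrapT => /eqP pP.
have [qd qdE] := dpoly (P - 1%:M).
have [N [q qE]] := ratfun_pev p (ratmap_affine (fun=> P - 1%:M) 1 bb).
have P1 : affine_mx (fun=> P - 1%:M) (fun _ : 'I_1 => 1) = P.
  by rewrite /affine_mx big_ord1 scale1r addrC subrK.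
have q0 : q != 0.
  have := qE (fun=> 1); rewrite meval_det_affine P1 => e.
  have dP : \det P != 0 by move: uP; rewrite unitmxE unitfE.
  apply: contra_neq (mulf_neq0 pP (expf_neq0 N dP)) => q0.
  by rewrite e // q0 meval0.
have qd0 : qd != 0.
  have := qdE (fun=> 0); rewrite /affine_mx big_ord1 scale0r addr0.
  by move=> e; apply: contraNneq d1 => qd0; rewrite -e qd0 meval0.
have [x] := mpoly_neq0_eval (mulf_neq0 (mulf_neq0 q0 qd0) (det_affine_neq0 (fun=> P - 1%:M) 1)).
rewrite !mevalM !mulf_eq0 !negb_or => /andP[/andP[qx qdx] dx].
move: qx; rewrite -qE // p0 ?mul0r ?eqxx //.
apply: dslice; first by rewrite unitmxE unitfE -meval_det_affine.
by rewrite -qdE.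
Qed.

End OrbitMaps.

(** * The differential of an orbit map *)

Section Tangent.
Variables (F : numFieldType) (n : nat) (W : vectType F) (beta : 'M[F]_n -> 'M[F]_n -> W).
Variables (E : nat -> 'M[F]_n) (d : nat) (lam : nat -> W -> F).
Hypothesis beta_bil : bilinear_map beta.
Hypothesis lam_lin : forall j, linear (lam j : W -> F^o).

(** The differential at the identity of the orbit map [point], in the direction [X]. *)
Definition tangent X := beta X 1%:M - beta 1%:M X.

Hypothesis lam_dual : forall i j, (i < d)%N -> (j < d)%N -> lam j (tangent (E i)) = (i == j)%:R.

Local Notation point P := (beta P (invmx P)).

Lemma tangent_linear : linear tangent.
Proof.
move=> a P Q; rewrite /tangent (proj1 beta_bil) (proj2 beta_bil).
by rewrite scalerBr opprD addrACA.
Qed.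

Let lamD j : {morph lam j : x y / x + y}.
Proof. by move=> x y; have := lam_lin j 1 x y; rewrite scale1r => ->; rewrite /GRing.scale /= mul1r. Qed.

Let lam0 j : lam j 0 = 0.
Proof. by apply: (addrI (lam j 0)); rewrite -lamD !addr0. Qed.

Let lamZ j a x : lam j (a *: x) = a * lam j x.
Proof. by have := lam_lin j a x 0; rewrite !addr0 lam0 addr0. Qed.

Lemma lam_tangent_sum k (x : 'I_k -> F) (j : 'I_k) : (k <= d)%N ->
  lam j (tangent (\sum_i x i *: E i)) = x j.
Proof.
move=> kd; have tD : {morph tangent : x y / x + y}.
  by move=> P Q; have := tangent_linear 1 P Q; rewrite !scale1r.
have t0 : tangent 0 = 0 by apply: (addrI (tangent 0)); rewrite -tD !addr0.
rewrite (big_morph _ tD t0) (big_morph _ (lamD j) (lam0 j)) (bigD1 j) //=.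
have tZ a P : tangent (a *: P) = a *: tangent P.
  by have := tangent_linear a P 0; rewrite !addr0 t0 addr0.
have h (i : 'I_k) : lam j (tangent (x i *: E i)) = x i * (i == j)%:R.
  by rewrite tZ lamZ lam_dual ?(leq_trans (ltn_ord _) kd).
rewrite h eqxx mulr1 big1 ?addr0 // => i ij.
by rewrite h (negPf ij) mulr0.
Qed.

(** A first order Taylor expansion along the line [1%:M + t *: X] with exact remainder, obtained by
    substituting [invmx P = 1 - t X (invmx P)] repeatedly. *)
Lemma point_expansion j (X : 'M[F]_n) t (P := 1%:M + t *: X) : P \in unitmx ->
  lam j (point P) - lam j (beta 1%:M 1%:M) =
  t * (lam j (tangent X) +
       t * lam j (beta 1%:M (X *m X *m invmx P) - beta X (X *m invmx P))).
Proof.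
move=> uP; have [bl br] := beta_bil.
have lamN x : lam j (- x) = - lam j x by rewrite -scaleN1r lamZ mulN1r.
have PiE : invmx P = (- t) *: (X *m invmx P) + 1%:M.
  rewrite -(mulmxV uP) {4}/P mulmxDl mul1mx -scalemxAl addrCA -scalerDl addNr.
  by rewrite scale0r addr0.
have XPiE : X *m invmx P = (- t) *: (X *m X *m invmx P) + X.
  by rewrite {1}PiE mulmxDr mulmx1 -scalemxAr mulmxA.
have e1 : beta 1%:M (invmx P) = - t *: (- t *: beta 1%:M (X *m X *m invmx P) + beta 1%:M X)
   + beta 1%:M 1%:M by rewrite {1}PiE br XPiE br.
have e2 : beta X (invmx P) = - t *: beta X (X *m invmx P) + beta X 1%:M by rewrite {1}PiE br.
have -> : point P = t *: beta X (invmx P) + beta 1%:M (invmx P).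
  by rewrite -bl /P addrC.
rewrite e1 e2 /tangent !(lamD, lamZ, lamN); ring.
Qed.

(* If Q vanished identically on the slice, then so would, on the tangent space,
   its lowest homogeneous part. *)
Lemma slice_alg_indep k (Q : {mpoly F[k]}) : (k <= d)%N ->
  (forall x : 'I_k -> F, affine_mx E x \in unitmx ->
     Q.@[fun j => lam j (point (affine_mx E x)) - lam j (beta 1%:M 1%:M)] = 0) ->
  Q = 0.
Proof.
move=> kd Q0; apply/eqP/negPn/negP => Qn0.
have [m0 m0Q m0min] : exists2 m0, m0 \in msupp Q & forall m, m \in msupp Q -> (mdeg m0 <= mdeg m)%N.
  have ex : exists e, has (fun m => mdeg m == e) (msupp Q).
    move: Qn0; rewrite -msupp_eq0; case: (msupp Q) => // m s _; exists (mdeg m).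
    by rewrite /= eqxx.
  case: (ex_minnP ex) => e /hasP[m0 m0Q /eqP em0] emin; exists m0 => // m mQ.
  by rewrite em0; apply: emin; apply/hasP; exists m.
(* The homogeneous part of [Q] of lowest degree. *)
pose Qk := \sum_(m <- msupp Q) (Q@_m * (mdeg m == mdeg m0)%:R) *: 'X_[F, m].
have Qk0 : Qk != 0.
  apply/eqP => /(congr1 (mcoeff m0)); rewrite mcoeff0 raddf_sum /=.
  rewrite (bigD1_seq m0) ?msupp_uniq //= big1 => [|m mm0].
    rewrite mcoeffZ mcoeffX !eqxx !mulr1 addr0 => /eqP; by rewrite mcoeff_eq0 m0Q.
  by rewrite mcoeffZ mcoeffX (negPf mm0) mulr0.
have [x Qkx] := mpoly_neq0_eval Qk0.
pose X := \sum_i x i *: E i.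
pose D := det_affine (fun=> X) 1.
have D0 : D.@[fun=> 0] = 1.
  by rewrite meval_det_affine /affine_mx big1 ?addr0 ?det1 // => i _; rewrite scale0r.
have hR (j : 'I_k) : exists q : {mpoly F[1]}, forall s, q.@[s] =
   lam j (beta 1%:M (X *m X *m \adj (affine_mx (fun=> X) s)) - beta X (X *m \adj (affine_mx (fun=> X) s))).
  pose L M := lam j (beta 1%:M (X *m X *m M) - beta X (X *m M)).
  have [|q qE] := @mpoly_linear F n 1 L (\adj (affine_mpoly_mx (fun=> X) 1)).
    move=> a M M'; rewrite /L !mulmxDr -!scalemxAr !(proj2 beta_bil).
    rewrite opprD addrACA -scalerBr; exact: lam_lin.
  by exists q => s; rewrite qE meval_adj_affine.
have {hR}[R RE] := choice hR.
pose T : {mpoly F[1]} := 'X_0.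
pose N := msize Q.
(* Up to the factor [D ^+ N], this is [Q] along the curve through the slice in the direction [x],
   divided by [T ^+ mdeg m0]. As [N] exceeds every degree in [Q], the subtraction [N - mdeg m] is
   not truncated. *)
pose H := \sum_(m <- msupp Q) Q@_m *: (T ^+ (mdeg m - mdeg m0) * D ^+ (N - mdeg m)
   * \prod_j (x j *: D + T * R j) ^+ m j).
have key s : D.@[s] != 0 -> s 0 ^+ mdeg m0 * H.@[s] = 0.
  move=> Ds; pose t := s 0.
  have PE : affine_mx (fun=> X) s = 1%:M + t *: X by rewrite /affine_mx big_ord1.
  have PE' : affine_mx E (fun i => t * x i) = affine_mx (fun=> X) s.
    rewrite PE /affine_mx scaler_sumr; congr (_ + _); apply: eq_bigr => i _.
    by rewrite scalerA.
  have uP : affine_mx (fun=> X) s \in unitmx by rewrite unitmxE unitfE -meval_det_affine.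
  pose z (j : 'I_k) := lam j (point (affine_mx (fun=> X) s)) - lam j (beta 1%:M 1%:M).
  have zE j : z j * D.@[s] = t * (x j * D.@[s] + t * (R j).@[s]).
    rewrite /z PE point_expansion -?PE // lam_tangent_sum // RE invmx_adj; last first.
      by rewrite -meval_det_affine.
    rewrite -meval_det_affine -/D -!scalemxAr.
    have bZ P a Q' : beta P (a *: Q') = a *: beta P Q'.
      have b0 : beta P 0 = 0.
        by have := proj2 beta_bil P (-1) 0 0; rewrite scaler0 addr0 scaleN1r addNr.
      by have := proj2 beta_bil P a Q' 0; rewrite b0 !addr0.
    by rewrite !bZ -scalerBr lamZ; field.
  have Qz : Q.@[z] = 0.
    by have := Q0 (fun i => t * x i); rewrite PE'; apply.
  have -> : s 0 ^+ mdeg m0 * H.@[s] = D.@[s] ^+ N * Q.@[z]; last by rewrite Qz mulr0.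
  rewrite /H (mevalE z Q) raddf_sum /= !mulr_sumr; apply: eq_big_seq => m mQ.
  rewrite mevalZ !mevalM !rmorphXn /= rmorph_prod /= mevalXU.
  have -> : \prod_j (((x j *: D + T * R j) ^+ m j).@[s]) =
    \prod_j ((x j * D.@[s] + t * (R j).@[s]) ^+ m j).
    by apply: eq_bigr => j _; rewrite rmorphXn /= mevalD mevalZ mevalM mevalXU.
  rewrite mulrCA [RHS]mulrCA; congr (_ * _).
  rewrite !mulrA -exprD subnKC ?m0min // mulrAC.
  have -> : t ^+ mdeg m = \prod_j t ^+ m j by rewrite mdegE prodrXr.
  rewrite -big_split /=.
  have -> : \prod_i (t ^+ m i * (x i * D.@[s] + t * (R i).@[s]) ^+ m i) =
     D.@[s] ^+ mdeg m * \prod_i z i ^+ m i.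
    rewrite mdegE -prodrXr -big_split /=; apply: eq_bigr => j _.
    by rewrite -!exprMn -zE mulrC.
  by rewrite mulrAC -exprD subnKC // ltnW // msize_mdeg_lt.
(* [D * (T ^+ mdeg m0 * H)] vanishes at every point, and the polynomial ring is a domain. *)
have H0 : H = 0.
  have : D * (T ^+ mdeg m0 * H) = 0.
    apply: mpoly_eval0 => s; rewrite !mevalM rmorphXn /= mevalXU.
    have [->|Ds] := eqVneq D.@[s] 0; first by rewrite mul0r.
    by rewrite key ?mulr0.
  move/eqP; rewrite !mulf_eq0 (negPf (det_affine_neq0 _ _)) /= expf_eq0.
  have /negPf-> : T != 0.
    have T1 : T.@[fun=> 1] = 1 by exact: mevalXU.
    by apply: contra_eq_neq T1 => ->; rewrite meval0 eq_sym oner_eq0.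
  by rewrite andbF => /eqP.
(* At the origin [T] is 0 and [D] is 1, so only the monomials of lowest degree survive in [H]. *)
case/eqP: Qkx; suff -> : Qk.@[x] = H.@[fun=> 0] by rewrite H0 meval0.
rewrite /Qk /H !raddf_sum /=; apply: eq_big_seq => m mQ.
rewrite !mevalZ !mevalM !rmorphXn /= rmorph_prod /= mevalXU D0 expr1n mulr1 -mulrA.
congr (_ * _); rewrite mevalX expr0n subn_eq0 eqn_leq (m0min m mQ) andbT; congr (_ * _).
by apply: eq_bigr => j _; rewrite rmorphXn /= mevalD mevalZ mevalM mevalXU D0 mul0r addr0 mulr1.
Qed.

End Tangent.

Section OrbitDimension.
Variables (F : numFieldType) (n : nat) (W : vectType F).
Implicit Type beta : 'M[F]_n -> 'M[F]_n -> W.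

(** The differential of the orbit map is injective on the directions of the slice; the use of
    coordinates makes the [E i] independent as well. *)
Definition transverse beta (E : nat -> 'M[F]_n) d :=
  forall x : 'I_d -> F, tangent beta (\sum_i x i *: E i) = 0 -> forall i, x i = 0.

(** The tangent vectors are the rows of a row-free matrix, and the columns of a right inverse are
    the dual forms. *)
Lemma transverse_dual beta E d : bilinear_map beta -> transverse beta E d ->
  exists G : 'M[F]_(dim W, d), forall i j : 'I_d,
    (v2r (tangent beta (E i)) *m G) 0 j = (i == j)%:R.
Proof.
move=> bb tr; pose A := \matrix_(i < d) v2r (tangent beta (E i)).
have /row_freeP[G GE] : row_free A.
  rewrite -kermx_eq0; apply/eqP/row_matrixP => l; rewrite row0.
  have : row l (kermx A) *m A = 0 by rewrite -row_mul mulmx_ker row0.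
  move: (row l _) => u uA; apply/rowP => i; rewrite [RHS]mxE.
  apply: (tr (fun i => u 0 i)); apply: v2r_inj; rewrite linear0 -uA mulmx_sum_row.
  have tl := tangent_linear bb.
  have tD : {morph tangent beta : x y / x + y}.
    by move=> P Q; have := tl 1 P Q; rewrite !scale1r.
  have t0 : tangent beta 0 = 0 by apply: (addrI (tangent beta 0)); rewrite -tD !addr0.
  rewrite (big_morph _ tD t0) (linear_sum (@v2r _ W)); apply: eq_bigr => j _.
  have tZ a P : tangent beta (a *: P) = a *: tangent beta P.
    by have := tl a P 0; rewrite !addr0 t0 addr0.
  by rewrite tZ rowK linearZ.
exists G => i j; have := congr1 (fun M : 'M_d => M i j) GE; rewrite [RHS]mxE => <-.
by rewrite !mxE; apply: eq_bigr => l _; rewrite [in RHS]mxE.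
Qed.

(* On the slice of dimension k any k+1 functions are algebraically dependent, while
   k+1 linear forms dual to the tangent vectors are independent on the next one. *)
Lemma slice_strict beta E d k : bilinear_map beta -> transverse beta E d -> (k < d)%N ->
  ~ (affine_slice beta E k.+1 `<=` zcl (affine_slice beta E k)).
Proof.
move=> bb tr kd sub; have [G GE] := transverse_dual bb tr.
(* The dual forms, extended by 0 to the indices from [d] on. *)
pose lam (j : nat) (w : W) : F := if insub j is Some i then (v2r w *m G) 0 i else 0.
have lam_lin j : linear (lam j : W -> F^o).
  move=> a u v; rewrite /lam; case: insub => [i|]; last by rewrite scaler0 addr0.
  by rewrite (linearP (@v2r _ W)) mulmxDl -scalemxAl !mxE.
have lam_dual i j : (i < d)%N -> (j < d)%N -> lam j (tangent beta (E i)) = (i == j)%:R.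
  by move=> ld jd; rewrite /lam insubT; have := GE (Ordinal ld) (Ordinal jd).
have hp (j : 'I_k.+1) : exists p : {mpoly F[dim W]}, forall w,
    pev p w = lam j w - lam j (beta 1%:M 1%:M).
  have jd := leq_trans (ltn_ord j) kd.
  exists (\sum_l G l (Ordinal jd) *: 'X_l - (lam j (beta 1%:M 1%:M))%:MP) => w.
  rewrite /pev mevalB mevalC raddf_sum /=; congr (_ - _).
  rewrite /lam insubT mxE; apply: eq_bigr => l _.
  by rewrite mevalZ mevalXU mulrC.
have [p pE] := choice hp.
have [Q /eqP Q0 QE] := ratimage_alg_dep p (ratmap_affine E k bb); apply: Q0.
apply: (slice_alg_indep bb lam_lin lam_dual kd) => x ux.
have /sub/QE : affine_slice beta E k.+1 (beta (affine_mx E x) (invmx (affine_mx E x))).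
  by apply/affine_sliceP; exists x.
by under meval_eq do rewrite pE.
Qed.

(** The generic slices, whose closures cover [X], give the upper bound for all orbits at once; a
    single transverse orbit supplies a chain of length [d]. *)
Theorem has_dim_orbits r (beta : 'I_r -> 'M[F]_n -> 'M[F]_n -> W) E d (X : set W) :
  (forall i, bilinear_map (beta i)) -> (forall i, generic_slice (beta i) E d) ->
  (forall x, X x <-> exists i, orbit_of (beta i) x) ->
  (exists i, transverse (beta i) E d) -> has_dim X d.
Proof.
move=> bb gs XE [i tr].
have sliceX k : affine_slice (beta i) E k `<=` X.
  by move=> x /affine_slice_sub xo; apply/XE; exists i.
split; last first.
  apply: chain_bound (fun i => ratmap_affine E d (bb i)) _ => x /XE[j xj].
  by exists j; apply: orbit_sub_zcl_slice.
exists (fun k => X `&` zcl (affine_slice (beta i) E k)); split=> k kd.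
  split; first by exists (zcl (affine_slice (beta i) E k)) => //; apply: zariski_closed_zcl.
  apply: irreducible_zcl => //; apply: irreducible_ratimage (det_affine_neq0 _ _) _.
  exact: ratmap_affine.
split; first by move=> x [Xx xk]; split=> //; apply: zclS xk; apply: affine_sliceS.
move=> sub; apply: (slice_strict (bb i) tr kd) => x xk.
by case: (sub x) => //; split; [exact: sliceX xk|exact: sub_zcl].
Qed.

End OrbitDimension.

(** * Orbits of conjugation *)

Lemma mx_conjP (F : fieldType) n (M D Q : 'M[F]_n) : Q \in unitmx ->
  (M = Q *m D *m invmx Q) <-> (M *m Q = Q *m D).
Proof.
move=> uQ; split=> [->|h]; first by rewrite mulmxKV.
by rewrite -h mulmxK.
Qed.

Section PositionSlices.
Variables (F : numFieldType) (n : nat).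
Implicit Types (A : {pred 'I_n.+1 * 'I_n.+1}) (P Q X D : 'M[F]_n.+1).

(** The elementary matrices at the positions in [A], enumerated by naturals; the default of [nth]
    concerns indices from [#|A|] on. *)
Definition pos_mx A (i : nat) : 'M[F]_n.+1 :=
  let p := nth (ord0, ord0) (enum A) i in delta_mx p.1 p.2.

Lemma pos_mx_sumE A (x : 'I_#|A| -> F) (i : 'I_#|A|) :
  (\sum_i x i *: pos_mx A i) (enum_val i).1 (enum_val i).2 = x i.
Proof.
have nthE (j : 'I_#|A|) : nth (ord0, ord0) (enum A) j = enum_val j by rewrite -enum_val_nth.
rewrite summxE (bigD1 i) //= big1 ?addr0 => [|j ji].
  by rewrite !mxE nthE !eqxx mulr1.
rewrite !mxE nthE -xpair_eqE -!surjective_pairing (inj_eq enum_val_inj) eq_sym.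
by rewrite (negPf ji) mulr0.
Qed.

Lemma pos_mx_sum0 A (x : 'I_#|A| -> F) k l : (k, l) \notin A ->
  (\sum_i x i *: pos_mx A i) k l = 0.
Proof.
move=> klA; rewrite summxE big1 // => j _; rewrite !mxE.
have -> : nth (ord0, ord0) (enum A) j = enum_val j by rewrite -enum_val_nth.
rewrite -xpair_eqE -surjective_pairing.
by case: eqP => [e|]; rewrite ?mulr0 //; move: klA; rewrite e enum_valP.
Qed.

Lemma pos_mx_sum_eq0 A (x : 'I_#|A| -> F) :
  (forall k l, (k, l) \in A -> (\sum_i x i *: pos_mx A i) k l = 0) -> forall i, x i = 0.
Proof.
by move=> h i; rewrite -pos_mx_sumE h // -surjective_pairing enum_valP.
Qed.

Lemma affine_pos_mx A P : (forall k l, (k, l) \notin A -> P k l = (k == l)%:R) ->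
  exists x : 'I_#|A| -> F, affine_mx (pos_mx A) x = P.
Proof.
move=> PA; exists (fun i => (P - 1%:M) (enum_val i).1 (enum_val i).2).
rewrite /affine_mx; set S := \sum_i _.
suff -> : S = P - 1%:M by rewrite addrC subrK.
apply/matrixP => k l; have [klA|klA] := boolP ((k, l) \in A); last first.
  by rewrite pos_mx_sum0 // !mxE PA // subrr.
have := pos_mx_sumE (fun i => (P - 1%:M) (enum_val i).1 (enum_val i).2) (enum_rank_in klA (k, l)).
by rewrite enum_rankK_in.
Qed.

Lemma pos_slice (W : vectType F) (beta : 'M[F]_n.+1 -> 'M[F]_n.+1 -> W) A P :
  P \in unitmx -> (forall k l, (k, l) \notin A -> P k l = (k == l)%:R) ->
  affine_slice beta (pos_mx A) #|A| (beta P (invmx P)).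
Proof.
move=> uP /affine_pos_mx[x xP]; apply/affine_sliceP; exists x; by rewrite xP.
Qed.

Definition conj_map D P Q := P *m D *m Q.

Lemma conj_map_bilinear D : bilinear_map (conj_map D).
Proof.
split=> [Q|P] a M N; rewrite /conj_map; last by rewrite mulmxDr -scalemxAr.
by rewrite !mulmxDl -!scalemxAl.
Qed.

Lemma tangent_conj_map D X : tangent (conj_map D) X = X *m D - D *m X.
Proof. by rewrite /tangent /conj_map mulmx1 mul1mx. Qed.

Section DiagonalOrbit.
Variable s : 'rV[F]_n.+1.

(** The complementary positions support the centralizer of [diag_mx s]. *)
Definition off_diag : {pred 'I_n.+1 * 'I_n.+1} := [pred p | s 0 p.1 != s 0 p.2].

(** The projection onto the centralizer of [diag_mx s], over any ring so that it also applies to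
    matrices of polynomials. *)
Definition block_part (R : nzRingType) (M : 'M[R]_n.+1) : 'M[R]_n.+1 :=
  \matrix_(k, l) if s 0 k == s 0 l then M k l else 0.

Lemma diag_mx_comm X : comm_mx X (diag_mx s) -> forall k l, s 0 k != s 0 l -> X k l = 0.
Proof.
move=> /matrixP h k l kl; have := h k l.
rewrite mul_mx_diag mul_diag_mx !mxE [RHS]mulrC => /eqP.
by rewrite -subr_eq0 -mulrBr mulf_eq0 subr_eq0 [s 0 l == _]eq_sym (negPf kl) orbF => /eqP.
Qed.

Lemma block_part_comm X : comm_mx (block_part X) (diag_mx s).
Proof.
apply/matrixP => k l; rewrite mul_mx_diag mul_diag_mx !mxE.
by case: eqP => [->|_]; rewrite ?mul0r ?mulr0 // mulrC.
Qed.

(** If the block part [B] of [P] is invertible, [P *m invmx B] has block part 1 and gives the same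
    point of the orbit, because [B] commutes with [diag_mx s]. *)
Lemma generic_slice_diag :
  generic_slice (conj_map (diag_mx s)) (pos_mx off_diag) #|off_diag|.
Proof.
exists (fun P => \det (block_part P)); split.
- suff -> : block_part (1%:M : 'M[F]_n.+1) = 1%:M by rewrite det1 oner_eq0.
  apply/matrixP => k l; rewrite !mxE; case: (eqVneq k l) => [->|_]; first by rewrite eqxx.
  by rewrite if_same.
- move=> A; exists (\det (block_part (affine_mpoly_mx (fun=> A) 1))) => x.
  rewrite -det_map_mx -meval_affine_mx; congr (\det _).
  apply/matrixP => k l; rewrite !mxE; case: ifP => _ /=; rewrite ?meval0 //.
- move=> P uP dP; pose B := block_part P.
  have uB : B \in unitmx by rewrite unitmxE unitfE.
  have cB : comm_mx (invmx B) (diag_mx s).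
    by rewrite /comm_mx -[LHS](mulmxK uB) -[_ *m _ *m B]mulmxA -(block_part_comm P) -/B mulKmx.
  pose P' := P *m invmx B.
  have uP' : P' \in unitmx by rewrite unitmx_mul uP unitmx_inv.
  have -> : conj_map (diag_mx s) P (invmx P) = conj_map (diag_mx s) P' (invmx P').
    by apply/mx_conjP => //; rewrite /conj_map /P' !mulmxA mulmxKV // -!mulmxA cB.
  apply: pos_slice => // k l; rewrite inE negbK => /= /eqP kl.
  have := congr1 (fun M : 'M_n.+1 => M k l) (mulmxV uB); rewrite [RHS]mxE => <-.
  rewrite !mxE; apply: eq_bigr => m _; rewrite [in RHS]mxE kl.
  case: eqP => // /eqP h; rewrite (diag_mx_comm cB) ?mulr0 //.
  by rewrite eq_sym.
Qed.

Lemma transverse_diag : transverse (conj_map (diag_mx s)) (pos_mx off_diag) #|off_diag|.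
Proof.
move=> x; rewrite tangent_conj_map => /eqP; rewrite subr_eq0 => /eqP h.
by apply: pos_mx_sum_eq0 => k l; apply: diag_mx_comm.
Qed.

Lemma has_dim_diag_orbit : has_dim (orbit_of (conj_map (diag_mx s))) #|off_diag|.
Proof.
apply: (@has_dim_orbits F n.+1 _ 1 (fun=> conj_map (diag_mx s)) (pos_mx off_diag)).
- by move=> _; apply: conj_map_bilinear.
- by move=> _; apply: generic_slice_diag.
- by move=> x; split=> [|[]//]; exists 0.
- by exists 0; apply: transverse_diag.
Qed.

End DiagonalOrbit.

Definition triple_map (T : 'M[F]_n.+1 * 'M[F]_n.+1 * 'M[F]_n.+1) P Q :=
  (conj_map T.1.1 P Q, conj_map T.1.2 P Q, conj_map T.2 P Q).

Lemma triple_map_bilinear T : bilinear_map (triple_map T).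
Proof.
split=> [Q|P] a M N; rewrite /triple_map.
  by rewrite !(proj1 (conj_map_bilinear _)).
by rewrite !(proj2 (conj_map_bilinear _)).
Qed.

(** Scalars centralize every triple, so [P] may be scaled to have top left entry 1. This gives the
    same upper bound for every orbit, whatever the centralizer. *)
Lemma generic_slice_triple T :
  generic_slice (triple_map T) (pos_mx (predC1 (ord0, ord0))) (n.+1 * n.+1).-1.
Proof.
have -> : (n.+1 * n.+1).-1 = #|predC1 (ord0 : 'I_n.+1, ord0 : 'I_n.+1)|.
  by rewrite cardC1 card_prod card_ord.
exists (fun P => P ord0 ord0); split; first by rewrite mxE oner_eq0.
- by move=> A; exists (affine_mpoly_mx (fun=> A) 1 ord0 ord0) => x; rewrite -meval_affine_mx [RHS]mxE.
- move=> P uP P00; pose P' := (P ord0 ord0)^-1 *: P.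
  have uP' : P' \in unitmx by rewrite unitmxZ // unitfE invr_eq0.
  have -> : triple_map T P (invmx P) = triple_map T P' (invmx P').
    by rewrite /triple_map; congr (_, _, _); apply/mx_conjP => //;
      rewrite /P' /conj_map -!scalemxAr -!scalemxAl mulmxKV.
  apply: pos_slice => // k l; rewrite !inE negbK => /eqP[-> ->].
  by rewrite eqxx mxE mulVf.
Qed.

End PositionSlices.

Section TripleOrbits.
Variable F : numFieldType.
Implicit Type T : 'M[F]_4 * 'M[F]_4 * 'M[F]_4.

(** The kernel of the differential is the centralizer, hence scalar, while the directions of the
    slice have top left entry 0. *)
Lemma transverse_triple T : trivial_centralizer T ->
  transverse (triple_map T) (pos_mx F (predC1 (ord0, ord0))) 15.
Proof.
move=> tc; have -> : 15%N = #|predC1 (ord0 : 'I_4, ord0 : 'I_4)|.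
  by rewrite cardC1 card_prod card_ord.
move=> x; set X := \sum_i _ => tX0.
have /is_scalar_mxP[a Xa] : is_scalar_mx X.
  apply: tc; have : forall D, tangent (conj_map D) X = 0 -> comm_mx X D.
    by move=> D; rewrite tangent_conj_map => /eqP; rewrite subr_eq0 => /eqP.
  by move=> h; case: tX0 => h1 h2 h3; split; apply: h.
have a0 : a = 0.
  have := @pos_mx_sum0 F 3 (predC1 (ord0, ord0)) x ord0 ord0.
  by rewrite -/X Xa mxE eqxx mulr1n inE eqxx; apply.
by apply: pos_mx_sum_eq0 => k l _; rewrite -/X Xa a0 mxE mul0rn.
Qed.

(** The diagonal blocks have sizes 2, 1, 1 and occupy 4 + 1 + 1 of the 16 positions. *)
Lemma card_off_diag_spectrum (x y z : F) : uniq [:: x; y; z] ->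
  #|off_diag (spectrum x y z)| = 10%N.
Proof.
rewrite /= !inE negb_or => /and3P[/andP[/negPf xy /negPf xz] /negPf yz _].
rewrite -sum1_card (eq_bigl (fun p => true && (spectrum x y z 0 p.1 != spectrum x y z 0 p.2))) //.
rewrite -(pair_big_dep xpredT (fun k l => spectrum x y z 0 k != spectrum x y z 0 l) (fun _ _ => 1%N)) /=.
under eq_bigr do rewrite big_mkcond.
rewrite !big_ord_recl !big_ord0 !mxE /=.
by rewrite !eqxx ![y == x]eq_sym ![z == x]eq_sym ![z == y]eq_sym xy xz yz.
Qed.

Lemma has_dim_conj_class (x y z : F) : uniq [:: x; y; z] ->
  has_dim (conj_class (spectrum x y z)) 10.
Proof. by move=> u; have := has_dim_diag_orbit (spectrum x y z); rewrite card_off_diag_spectrum. Qed.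

Lemma has_dim_triples r (T : 'I_r -> 'M[F]_4 * 'M[F]_4 * 'M[F]_4) (X : set _) :
  (forall x, X x <-> exists i, orbit_of (triple_map (T i)) x) ->
  (exists i, trivial_centralizer (T i)) -> has_dim X 15.
Proof.
move=> XT [i tc]; apply: (has_dim_orbits _ _ XT).
- by move=> j; apply: triple_map_bilinear.
- by move=> j; apply: generic_slice_triple.
- by exists i; apply: transverse_triple.
Qed.

End TripleOrbits.

(** * Scott's lemma *)

Section RankAd.
Variable F : fieldType.

Lemma rank_diag_mx n (v : 'rV[F]_n) : \rank (diag_mx v) = (\sum_i (v 0%R i != 0%R))%N.
Proof.
elim: n v => [|n IHn] v; first by rewrite big_ord0 [diag_mx v]thinmx0 mxrank0.
have := diag_mx_row (lsubmx (v : 'rV_(1 + n))) (rsubmx (v : 'rV_(1 + n))).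
rewrite hsubmxK => e.
have -> : \rank (diag_mx v) = (\rank (diag_mx (lsubmx (v : 'rV_(1 + n))))
   + \rank (diag_mx (rsubmx (v : 'rV_(1 + n)))))%N by rewrite -rank_diag_block_mx -e.
rewrite IHn big_ord_recl; congr (_ + _)%N.
  rewrite rank_rV; congr (nat_of_bool (~~ _)); apply/eqP/eqP => [/matrixP/(_ 0 0)|h].
    by rewrite !mxE eqxx mulr1n => <-; congr (v _ _); apply: val_inj.
  apply/matrixP => i j; rewrite !ord1 !mxE eqxx mulr1n -[RHS]h; congr (v _ _); exact: val_inj.
by apply: eq_bigr => i _; rewrite mxE; congr (nat_of_bool (v _ _ != 0)); apply: val_inj.
Qed.

Definition ad m n (A : 'M[F]_m) (B : 'M[F]_n) : 'M[F]_(m * n) :=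
  lin_mulmx A - lin_mulmxr B.

Lemma mxvec_ad m n (A : 'M[F]_m) (B : 'M[F]_n) (Y : 'M_(m, n)) :
  mxvec Y *m ad A B = mxvec (A *m Y - Y *m B).
Proof. by rewrite mulmxBr !mul_vec_lin linearB. Qed.

Definition simd n (M : 'M[F]_n) (s : 'rV[F]_n) :=
  exists2 P, P \in unitmx & M = P *m diag_mx s *m invmx P.

Lemma mxvec_mx_eq m n k (A B : 'M[F]_(m * n, k)) :
  (forall Y : 'M_(m, n), mxvec Y *m A = mxvec Y *m B) -> A = B.
Proof.
by move=> h; apply/row_matrixP => i; rewrite !rowE -[delta_mx 0 i]vec_mxK.
Qed.

Lemma sum_mxvec_index m n (f : 'I_(m * n) -> nat) :
  (\sum_k f k = \sum_i \sum_j f (mxvec_index i j))%N.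
Proof.
rewrite pair_bigA /= (reindex (uncurry (@mxvec_index m n))) /=; last exact: curry_mxvec_bij.
by apply: eq_bigr => -[i j].
Qed.

(** In eigenbases of [A] and [B] the operator is diagonal with entries [s 0 i - t 0 j]. *)
Lemma rank_ad m n (A : 'M[F]_m) (B : 'M[F]_n) s t : simd A s -> simd B t ->
  \rank (ad A B) = (\sum_i \sum_j (s 0%R i != t 0%R j))%N.
Proof.
move=> [P uP AE] [Q uQ BE].
have [U UE] : exists U, forall Y, mxvec Y *m U = mxvec (invmx P *m Y *m Q).
  by exists (lin_mulmx (invmx P) *m lin_mulmxr Q) => Y; rewrite mulmxA !mul_vec_lin.
have [U' UE'] : exists U, forall Y, mxvec Y *m U = mxvec (P *m Y *m invmx Q).
  by exists (lin_mulmx P *m lin_mulmxr (invmx Q)) => Y; rewrite mulmxA !mul_vec_lin.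
have UU' : U *m U' = 1%:M.
  by apply: mxvec_mx_eq => Y; rewrite mulmx1 [LHS]mulmxA UE UE' -!mulmxA mulKVmx // mulmxV // mulmx1.
have [uU uU'] := mulmx1_unit UU'.
pose E := \matrix_(i, j) (s 0 i - t 0 j).
have -> : ad A B = U *m diag_mx (mxvec E) *m U'.
  apply: mxvec_mx_eq => Y; rewrite mxvec_ad !mulmxA UE.
  have -> : mxvec (invmx P *m Y *m Q) *m diag_mx (mxvec E) =
      mxvec (diag_mx s *m (invmx P *m Y *m Q) - (invmx P *m Y *m Q) *m diag_mx t).
    apply/rowP => k; case/mxvec_indexP: k => i j.
    rewrite mul_mx_diag mxE !mxvecE mxE [RHS]mxE mul_diag_mx mul_mx_diag [RHS]addrC !mxE.
    ring.
  rewrite UE' AE BE; congr (mxvec _).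
  by rewrite mulmxBr mulmxBl !mulmxA mulmxK // mulmxV // mul1mx.
rewrite mxrankMfree ?row_free_unit // eqmxMfull ?row_full_unit //.
rewrite rank_diag_mx sum_mxvec_index; apply: eq_bigr => i _; apply: eq_bigr => j _.
by rewrite mxvecE mxE subr_eq0.
Qed.

Lemma mxtrace_eq0 m n (N : 'M[F]_(n, m)) : (forall Y : 'M_(m, n), \tr (Y *m N) = 0) -> N = 0.
Proof.
move=> h; apply/matrixP => i j; rewrite [RHS]mxE -(h (delta_mx j i)) /mxtrace.
rewrite (bigD1 j) //= big1 ?addr0 => [|k kj].
  rewrite mxE (bigD1 i) //= big1 ?addr0 => [|l li]; first by rewrite mxE !eqxx mul1r.
  by rewrite mxE (negPf li) andbF mul0r.
by rewrite mxE big1 // => l _; rewrite mxE (negPf kj) mul0r.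
Qed.

Lemma mxvec_functional m n (z : 'cV[F]_(m * n)) :
  exists N : 'M[F]_(n, m), forall Y : 'M_(m, n), (mxvec Y *m z) 0 0 = \tr (Y *m N).
Proof.
exists (\matrix_(j, i) z (mxvec_index i j) 0) => Y.
rewrite mxE (reindex (uncurry (@mxvec_index m n))) /=; last exact: curry_mxvec_bij.
rewrite /mxtrace; under [RHS]eq_bigr do rewrite mxE.
by rewrite pair_bigA /=; apply: eq_bigr => -[i j] _ /=; rewrite mxvecE mxE.
Qed.

End RankAd.

Section Scott.
Variable F : fieldType.

Definition i0 : 'I_3 := Ordinal (isT : (0 < 3)%N).
Definition i1 : 'I_3 := Ordinal (isT : (1 < 3)%N).
Definition i2 : 'I_3 := Ordinal (isT : (2 < 3)%N).

Lemma forall_ord3 (P : 'I_3 -> Prop) : P i0 -> P i1 -> P i2 -> forall j, P j.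
Proof.
move=> P0 P1 P2 [[|[|[|//]]] h].
- by rewrite (_ : Ordinal h = i0) //; apply: val_inj.
- by rewrite (_ : Ordinal h = i1) //; apply: val_inj.
- by rewrite (_ : Ordinal h = i2) //; apply: val_inj.
Qed.

Definition prod3 n (M : 'I_3 -> 'M[F]_n) := M i0 *m M i1 *m M i2.

Definition intertwines m n (M : 'I_3 -> 'M[F]_m) (N : 'I_3 -> 'M[F]_n) (X : 'M[F]_(m, n)) :=
  forall j, M j *m X = X *m N j.

Section TwoTriples.
Variables (m n : nat) (M : 'I_3 -> 'M[F]_m) (N : 'I_3 -> 'M[F]_n).
Hypotheses (M1 : prod3 M = 1%:M) (N1 : prod3 N = 1%:M).

Definition rank_ad_sum :=
  (\rank (ad (M i0) (N i0)) + (\rank (ad (M i1) (N i1)) + \rank (ad (M i2) (N i2))))%N.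

(** The left side is the off-diagonal block in the product of three block triangular matrices with
    diagonal blocks [M j], [N j] and off-diagonal blocks [X j]. *)
Definition cocycle (X : 'I_3 -> 'M[F]_(m, n)) :=
  X i0 *m N i1 *m N i2 + M i0 *m X i1 *m N i2 + M i0 *m M i1 *m X i2 = 0.

Let a j := ad (M j) (N j).
(** [D] is the coboundary map, [K] applies [a j] to the component [j], and the kernel of [C]
    consists of the cocycles. *)
Let D := row_mx (a i0) (row_mx (a i1) (a i2)).
Let K := block_mx (a i0) 0 0 (block_mx (a i1) 0 0 (a i2)).
Let C := col_mx (lin_mulmxr (N i1 *m N i2))
  (col_mx (lin_mulmx (M i0) *m lin_mulmxr (N i2)) (lin_mulmx (M i0 *m M i1)))
  : 'M[F]_(_, m * n).

Let triple_row (X : 'I_3 -> 'M[F]_(m, n)) :=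
  row_mx (mxvec (X i0)) (row_mx (mxvec (X i1)) (mxvec (X i2))).

Let triple_rowC X : triple_row X *m C = mxvec
  (X i0 *m N i1 *m N i2 + M i0 *m X i1 *m N i2 + M i0 *m M i1 *m X i2).
Proof.
by rewrite !mul_row_col mulmxA !mul_vec_lin /= !linearD /= !mulmxA addrA.
Qed.

Let triple_rowK X : triple_row X *m K = triple_row (fun j => M j *m X j - X j *m N j).
Proof. by rewrite !mul_row_block !mulmx0 !addr0 !add0r !mxvec_ad. Qed.

Let rowD Y : mxvec Y *m D = triple_row (fun j => M j *m Y - Y *m N j).
Proof. by rewrite !mul_mx_row !mxvec_ad. Qed.

Let triple_row_surj u : exists X, u = triple_row X.
Proof.
pose v := rsubmx u.
exists (fun j => if j == i0 then vec_mx (lsubmx u) else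
  if j == i1 then vec_mx (lsubmx v) else vec_mx (rsubmx v)).
by rewrite /triple_row /= !vec_mxK !hsubmxK.
Qed.

Let DK : (D <= K)%MS.
Proof.
apply/row_subP => i; rewrite rowE -[delta_mx 0 i]vec_mxK rowD.
by rewrite -(triple_rowK (fun=> _)) submxMl.
Qed.

Let DC : D *m C = 0.
Proof.
apply: mxvec_mx_eq => Y; rewrite mulmxA rowD triple_rowC mulmx0 -[RHS](linear0 (@mxvec F m n)).
congr mxvec; rewrite !mulmxBr !mulmxBl !mulmxA -/(prod3 M) M1 mul1mx.
have -> : Y *m N i0 *m N i1 *m N i2 = Y by rewrite -!mulmxA [N i0 *m _]mulmxA -/(prod3 N) N1 mulmx1.
by rewrite [X in X + _ = _]addrC !subrKA subrr.
Qed.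

Let rankK : \rank K = rank_ad_sum.
Proof. by rewrite !rank_diag_block_mx. Qed.

(** The image of [D] lies in that of [K] and in the kernel of [C], and their intersection has
    dimension [\rank K - \rank (K *m C)]. *)
Let rank_bound : (\rank D + \rank (K *m C) <= rank_ad_sum)%N.
Proof.
rewrite -rankK -(mxrank_mul_ker K C) addnC leq_add2l mxrankS // sub_capmx DK.
by apply/sub_kermxP.
Qed.

(* Scott's lemma: K *m C has corank at least one unless D has a kernel, and the
   functionals vanishing on its image are intertwiners from N to M. *)
Lemma scott : (rank_ad_sum < (m * n).*2)%N ->
  (exists2 X : 'M_(m, n), X != 0 & intertwines M N X) \/
  (exists2 X : 'M_(n, m), X != 0 & intertwines N M X).
Proof.
move=> lt; have [fD|nfD] := boolP (row_free D); last first.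
  left; move: nfD; rewrite -kermx_eq0 => /rowV0Pn[u /sub_kermxP uD u0].
  exists (vec_mx u); first by rewrite -(linear0 (@vec_mx F m n)) (can_eq vec_mxK).
  have := rowD (vec_mx u); rewrite vec_mxK uD => /esym h.
  have h0 : triple_row (fun=> 0) = 0 by rewrite /triple_row !linear0 !row_mx0.
  move: h; rewrite -h0 => /eq_row_mx[e0 /eq_row_mx[e1 e2]].
  by apply: forall_ord3; apply/eqP; rewrite -subr_eq0; apply/eqP/(can_inj mxvecK).
(* Otherwise [D] and [K *m C] would both have rank [m * n], against [rank_bound]. *)
right; have nf : ~~ row_full (K *m C).
  apply: contraL lt => /eqnP fKC; rewrite -leqNgt -addnn.
  by apply: leq_trans rank_bound; rewrite fKC (eqnP fD).
have : cokermx (K *m C) != 0.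
  by rewrite cokermx_eq0.
case/matrix0Pn => k [l kl]; pose z := cokermx (K *m C) *m delta_mx l 0 : 'cV_(m * n).
have KCz X : triple_row X *m K *m C *m z = 0.
  by rewrite -(mulmxA (triple_row X) K C) /z [LHS]mulmxA -(mulmxA (triple_row X) (K *m C)) mulmx_coker mulmx0 mul0mx.
(* The functional that kills the image of [K *m C] is represented by a matrix through the trace
   form. *)
have [Z ZE] := mxvec_functional z.
have Z0 : Z != 0.
  apply: contraNneq kl => Z0.
  suff z0 : z = 0.
    by have := congr1 (fun A : 'cV_(m * n) => A k 0) z0; rewrite /z -colE !mxE => ->.
  apply: mxvec_mx_eq => Y; apply/matrixP => i j.
  by rewrite !ord1 ZE Z0 !mulmx0 linear0 mxE.
have ZC X : \tr ((let Y j := M j *m X j - X j *m N j in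
   Y i0 *m N i1 *m N i2 + M i0 *m Y i1 *m N i2 + M i0 *m M i1 *m Y i2) *m Z) = 0.
  by rewrite -ZE -triple_rowC -triple_rowK KCz mxE.
(* Testing on triples supported at [i0] and cycling the trace isolates the relation at this index;
   [Z_2] is obtained in the same way. *)
have Z_0 : Z *m M i0 = N i0 *m Z.
  have ZC0 Y : \tr ((M i0 *m Y - Y *m N i0) *m N i1 *m N i2 *m Z) = 0.
    have := ZC (fun j => if j == i0 then Y else 0).
    by rewrite /= !mulmx0 !mul0mx !subr0 !(mul0mx, mulmx0) !addr0.
  have h : N i1 *m N i2 *m Z *m M i0 - Z = 0.
    apply: mxtrace_eq0 => Y; rewrite -[RHS](ZC0 Y) !mulmxBl mulmxBr !linearB /=; congr (_ - _).
      by rewrite -[in RHS]mulmxA -[in RHS]mulmxA -[in RHS]mulmxA [RHS]mxtrace_mulC !mulmxA.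
    by congr (\tr _); rewrite -!mulmxA [N i0 *m _]mulmxA [N i0 *m _ *m _]mulmxA -/(prod3 N) N1 mul1mx.
  move/eqP: h; rewrite subr_eq0 => /eqP h.
  by rewrite -{2}h !mulmxA -/(prod3 N) N1 mul1mx.
have Z_2 : Z *m M i2 = N i2 *m Z.
  have ZC2 Y : \tr (M i0 *m M i1 *m (M i2 *m Y - Y *m N i2) *m Z) = 0.
    have := ZC (fun j => if j == i2 then Y else 0).
    by rewrite /= !mulmx0 !mul0mx !subr0 !(mul0mx, mulmx0) !add0r.
  have h : Z - N i2 *m Z *m M i0 *m M i1 = 0.
    apply: mxtrace_eq0 => Y; rewrite -[RHS](ZC2 Y) [in RHS]mulmxBr mulmxBl mulmxBr !linearB /=; congr (_ - _).
      by rewrite !mulmxA -/(prod3 M) M1 mul1mx.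
    by rewrite -[in RHS]mulmxA [RHS]mxtrace_mulC !mulmxA.
  move/eqP: h; rewrite subr_eq0 => /eqP h.
  by rewrite {1}h -!mulmxA [M i0 *m _]mulmxA -/(prod3 M) M1 mulmx1.
exists Z => //; apply: forall_ord3 => //.
(* The relation at [i1] follows from the other two and the product relations, after cancelling
   [N i0] and [M i2]. *)
have uN0 : N i0 \in unitmx.
  have e : N i0 *m (N i1 *m N i2) = 1%:M by rewrite mulmxA.
  exact: (proj1 (mulmx1_unit e)).
have uM2 : M i2 \in unitmx by exact: (proj2 (mulmx1_unit M1)).
have e : N i0 *m (N i1 *m Z) *m M i2 = N i0 *m (Z *m M i1) *m M i2.
  rewrite -[in LHS]mulmxA -[in LHS]mulmxA Z_2 !mulmxA -/(prod3 N) N1 mul1mx -Z_0.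
  by rewrite -!mulmxA [M i0 *m _]mulmxA -/(prod3 M) M1 mulmx1.
by have := can_inj (mulmxK uM2) e => /(can_inj (mulKmx uN0)).
Qed.

(** The cocycles in the image of [K] have dimension at least [\rank K - m * n > m * n], and the
    coboundaries at most [m * n]. Staying in the image of [K] keeps each component of the extension
    similar to a direct sum. *)
Lemma ext_exists : ((m * n).*2 < rank_ad_sum)%N ->
  exists2 X, cocycle (fun j => M j *m X j - X j *m N j) &
    ~ exists Y, forall j, M j *m X j - X j *m N j = M j *m Y - Y *m N j.
Proof.
move=> lt; have : ~~ (K :&: kermx C <= D)%MS.
  apply: contraL lt => /mxrankS le; rewrite -leqNgt -rankK -(mxrank_mul_ker K C) -addnn.
  by apply: leq_add; [apply: rank_leq_col|apply: leq_trans le (rank_leq_row _)].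
case/row_subPn => i nD; have := row_sub i (K :&: kermx C)%MS.
rewrite sub_capmx => /andP[/submxP[u uK] /sub_kermxP uC].
have [X uX] := triple_row_surj u; exists X.
  have := triple_rowC (fun j => M j *m X j - X j *m N j).
  rewrite -triple_rowK -uX -uK uC => /esym e.
  by apply: (can_inj mxvecK); rewrite linear0.
move=> [Y XY]; case/negP: nD; rewrite uK uX triple_rowK.
have -> : triple_row (fun j => M j *m X j - X j *m N j) = mxvec Y *m D.
  by rewrite rowD /triple_row !XY.
exact: submxMl.
Qed.

End TwoTriples.
End Scott.

(** * Triples of 2 x 2 matrices *)

Section SimilarDiagonal.
Variable F : fieldType.

Lemma simdP n (M : 'M[F]_n) s :
  simd M s <-> exists2 P, P \in unitmx & M *m P = P *m diag_mx s.
Proof. by split=> -[P uP h]; exists P => //; apply/mx_conjP. Qed.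

Lemma simd_similar n (M N P : 'M[F]_n) s :
  P \in unitmx -> P *m M = N *m P -> simd M s -> simd N s.
Proof.
move=> uP PM /simdP[Q uQ MQ]; apply/simdP; exists (P *m Q); first by rewrite unitmx_mul uP.
by rewrite mulmxA -PM -!mulmxA MQ.
Qed.

Lemma simd_mxtrace n (M : 'M[F]_n) s : simd M s -> \tr M = \sum_i s 0 i.
Proof. by move=> [P uP ->]; rewrite mxtrace_mulC mulmxA mulVmx // mul1mx mxtrace_diag. Qed.

Lemma simd_det n (M : 'M[F]_n) s : simd M s -> \det M = \prod_i s 0 i.
Proof.
move=> [P uP ->]; rewrite !det_mulmx det_diag mulrAC -det_mulmx mulmxV // det1 mul1r.
by [].
Qed.

Lemma simd_eigenvalue n (M : 'M[F]_n) s (v : 'rV_n) (a : F) :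
  simd M s -> v != 0 -> v *m M = a *: v -> exists k, s 0 k = a.
Proof.
move=> /simdP[P uP MP] v0 vM.
have : v *m P != 0 by apply: contraNneq v0 => h; rewrite -(mulmxK uP v) h mul0mx.
case/rV0Pn => k vk; exists k; apply: (mulfI vk).
have := congr1 (fun w : 'rV_n => w 0 k) (mulmxA v M P).
by rewrite vM MP mulmxA mul_mx_diag -scalemxAl !mxE => ->; rewrite mulrC.
Qed.

Lemma simd_perm n (M : 'M[F]_n) s (f : 'I_n -> 'I_n) : injective f ->
  simd M s -> simd M (\row_k s 0 (f k)).
Proof.
move=> fI /simdP[P uP MP]; apply/simdP; exists (P *m (perm_mx (perm fI))^T).
  by rewrite unitmx_mul uP unitmx_tr unitmx_perm.
rewrite mulmxA MP -!mulmxA; congr (_ *m _); apply/matrixP => i j.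
rewrite mul_diag_mx mul_mx_diag !mxE permE.
by case: eqP => [->|_]; rewrite ?mulr0 ?mul0r ?mulr1 ?mul1r.
Qed.

Definition pair_row (x y : F) : 'rV[F]_2 := \row_k [:: x; y]`_k.

Definition mx2 (x y z t : F) : 'M[F]_2 :=
  \matrix_(i, j) (if i == 0 then (if j == 0 then x else y) else (if j == 0 then z else t)).

Lemma mx2_eta (M : 'M[F]_2) : M = mx2 (M 0 0) (M 0 1) (M 1 0) (M 1 1).
Proof.
apply/matrixP => i j; rewrite mxE.
by case: i => [[|[|//]]] hi; case: j => [[|[|//]]] hj /=; congr (M _ _); apply: val_inj.
Qed.

Lemma mul_mx2 x y z t x' y' z' t' : mx2 x y z t *m mx2 x' y' z' t' =
  mx2 (x * x' + y * z') (x * y' + y * t') (z * x' + t * z') (z * y' + t * t').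
Proof.
apply/matrixP => i j; rewrite !mxE !big_ord_recl big_ord0 !mxE addr0 /=.
by case: i => [[|[|//]]] hi; case: j => [[|[|//]]] hj.
Qed.

Lemma tr_mx2 x y z t : \tr (mx2 x y z t) = x + t.
Proof. by rewrite /mxtrace !big_ord_recl big_ord0 !mxE /= addr0. Qed.

Lemma det_mx2 x y z t : \det (mx2 x y z t) = x * t - y * z.
Proof.
rewrite (expand_det_row _ 0) !big_ord_recl big_ord0 /cofactor !mxE /= !det_mx11 !mxE /=.
ring.
Qed.

Lemma scalar_mx2 (x : F) : x%:M = mx2 x 0 0 x.
Proof.
apply/matrixP => i j; rewrite !mxE.
by case: i => [[|[|//]]] hi; case: j => [[|[|//]]] hj.
Qed.

(** The characteristic polynomial has the distinct roots [x] and [y], whose eigenvectors are the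
    rows of the invertible [R]. *)
Lemma simd_mx2 (N : 'M[F]_2) x y :
  \tr N = x + y -> \det N = x * y -> x != y -> simd N (pair_row x y).
Proof.
move=> trN detN xy.
have eig a : a ^+ 2 - (x + y) * a + x * y = 0 ->
    exists2 v : 'rV[F]_2, v != 0 & v *m N = a *: v.
  rewrite -trN -detN [N]mx2_eta tr_mx2 det_mx2 -mx2_eta => ha.
  have : \det (N - a%:M) = 0.
    rewrite -ha [N - _]mx2_eta det_mx2 !mxE /=; ring.
  move=> /eqP/det0P[v v0]; rewrite mulmxBr mul_mx_scalar => /eqP.
  by rewrite subr_eq0 => /eqP; exists v.
have [v v0 vN] : exists2 v : 'rV[F]_2, v != 0 & v *m N = x *: v by apply: eig; ring.
have [w w0 wN] : exists2 v : 'rV[F]_2, v != 0 & v *m N = y *: v by apply: eig; ring.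
pose R : 'M[F]_2 := \matrix_i (if i == 0 then v else w).
have RN : R *m N = diag_mx (pair_row x y) *m R.
  apply/row_matrixP => i; rewrite row_mul rowK.
  have -> : row i (diag_mx (pair_row x y) *m R) = pair_row x y 0 i *: row i R.
    by apply/rowP => j; rewrite mxE mul_diag_mx !mxE.
  by rewrite rowK mxE; case: i => [[|[|//]]] hi /=.
have free2 a b : a *: v + b *: w = 0 -> a = 0 /\ b = 0.
  move=> h; have h2 : a * x *: v + b * y *: w = 0.
    by have := congr1 (mulmx^~ N) h; rewrite /= mul0mx mulmxDl -!scalemxAl vN wN !scalerA.
  have a0 : a = 0.
    have : (a * (x - y)) *: v = (a * x *: v + b * y *: w) - y *: (a *: v + b *: w).
      by rewrite scalerDr !scalerA mulrBr scalerBl opprD addrACA [y * b]mulrC subrr addr0 [y * a]mulrC.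
    rewrite h h2 scaler0 subr0.
    move/eqP; rewrite scaler_eq0 (negPf v0) orbF mulf_eq0 subr_eq0 (negPf xy) orbF.
    by move/eqP.
  split=> //; move: h; rewrite a0 scale0r add0r => /eqP.
  by rewrite scaler_eq0 (negPf w0) orbF => /eqP.
have uR : R \in unitmx.
  rewrite -row_free_unit -kermx_eq0; apply/eqP/row_matrixP => i; rewrite row0.
  have : row i (kermx R) *m R = 0 by rewrite -row_mul mulmx_ker row0.
  move: (row i _) => u; rewrite mulmx_sum_row !big_ord_recl big_ord0 !rowK /= addr0.
  move=> /free2[a0 b0]; apply/rowP => k; rewrite [RHS]mxE.
  by case: k => [[|[|//]]] hk; [rewrite -a0|rewrite -b0]; congr (u _ _); apply: val_inj.
exists (invmx R); rewrite ?unitmx_inv // invmxK.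
by rewrite -mulmxA -RN mulKmx.
Qed.

End SimilarDiagonal.

Section IrreducibleTriples.
Variable F : fieldType.
Implicit Types A B : 'I_3 -> 'M[F]_2.

(** Irreducibility: a proper nonzero invariant subspace of a plane is a line spanned by a common
    eigenvector. *)
Definition irr2 A := forall v : 'rV[F]_2, v != 0 -> ~ (forall j, exists a, v *m A j = a *: v).

(** On a common eigenvector the three eigenvalues multiply to 1, because the matrices do. *)
Lemma irr2_nonresonant A (p q : 'I_3 -> F) : prod3 A = 1%:M ->
  (forall j, simd (A j) (pair_row (p j) (q j))) ->
  (forall e, (forall j, e j = p j \/ e j = q j) -> e i0 * e i1 * e i2 <> 1) -> irr2 A.
Proof.
move=> A1 sA nr v v0 /choice[e eE]; apply: (nr e) => [j|].
  have [k] := simd_eigenvalue (sA j) v0 (eE j).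
  by rewrite mxE; case: k => [[|[|//]]] hk /= <-; [left|right].
have /eqP : v *m prod3 A = (e i0 * e i1 * e i2) *: v.
  by rewrite /prod3 !mulmxA eE -scalemxAl eE -scalemxAl -scalemxAl eE !scalerA.
rewrite A1 mulmx1 -subr_eq0 -{1}[v]scale1r -scalerBl scaler_eq0 (negPf v0) orbF subr_eq0.
by move/eqP.
Qed.

(* The free entry k of A i1 is fixed by the trace of A i2. *)
Lemma rank2_triple_exists (p q : 'I_3 -> F) :
  (forall j, p j != q j) ->
  p i0 * q i0 * (p i1 * q i1) * (p i2 * q i2) = 1 ->
  exists A, prod3 A = 1%:M /\ forall j, simd (A j) (pair_row (p j) (q j)).
Proof.
move=> pq; move: (pq i0) (pq i1) (pq i2); move=> pq0 pq1 pq2.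
set a := p i0; set b := q i0; set f := p i1; set g := q i1; set u := p i2; set v := q i2 => e.
pose d := a * b * (f * g).
have d0 : d != 0 by apply: contra_eq_neq e => d0; rewrite -/d d0 mul0r eq_sym oner_eq0.
have dE : d^-1 = u * v by apply: (mulfI d0); rewrite mulfV // -e.
pose k := d * (u + v) - a * f - b * g.
(* The inverse of the product of the other two matrices, by the adjugate formula; [d] is the
   determinant of that product. *)
pose A2 := d^-1 *: mx2 (k + b * g) (- (a * k)) (- f) (a * f).
exists (fun j => if j == i0 then mx2 a 0 1 b else if j == i1 then mx2 f k 0 g else A2).
split.
  rewrite /prod3 /= mul_mx2 -scalemxAr mul_mx2.
  have -> : mx2 ((a * f + 0 * 0) * (k + b * g) + (a * k + 0 * g) * - f)
     ((a * f + 0 * 0) * - (a * k) + (a * k + 0 * g) * (a * f))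
     ((1 * f + b * 0) * (k + b * g) + (1 * k + b * g) * - f)
     ((1 * f + b * 0) * - (a * k) + (1 * k + b * g) * (a * f)) = d%:M.
    by rewrite scalar_mx2; congr mx2; rewrite /d; ring.
  by rewrite scale_scalar_mx mulVf.
apply: forall_ord3 => /=; apply: simd_mx2; rewrite ?tr_mx2 ?det_mx2 // -/a -/b -/f -/g -/u -/v; try ring.
- have kE : k + b * g + a * f = d * (u + v) by rewrite /k; ring.
  by rewrite /A2 mxtraceZ tr_mx2 kE mulKf.
- rewrite /A2 detZ det_mx2 (_ : _ - _ = d); last by rewrite /d; ring.
  by rewrite -dE expr2 mulfVK.
Qed.

(** The kernel of [X] is invariant under [A]; a nonzero proper one would be spanned by a common
    eigenvector. *)
Lemma irr2_row_free A n (M : 'I_3 -> 'M[F]_n) X :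
  irr2 A -> intertwines A M X -> X != 0 -> row_free X.
Proof.
move=> irr AX X0; rewrite -kermx_eq0; apply: contrapT => /negP/rowV0Pn[v vK v0].
apply: (irr v v0) => j; apply/sub_rVP.
have KX w : (w <= kermx X)%MS -> (w <= v)%MS.
  move=> wK; apply: submx_trans wK _.
  rewrite -(geq_leqif (mxrank_leqif_sup vK)) mxrank_ker rank_rV v0.
  by rewrite leq_subLR addn1 ltnS lt0n mxrank_eq0.
by apply: KX; apply/sub_kermxP; rewrite -mulmxA AX mulmxA (sub_kermxP vK) mul0mx.
Qed.

(** Dually, the row space of [X] is invariant under [A]. *)
Lemma irr2_row_full A n (M : 'I_3 -> 'M[F]_n) X :
  irr2 A -> intertwines M A X -> X != 0 -> row_full X.
Proof.
move=> irr AX /rowV0Pn[v vX v0]; apply: contrapT => nf.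
apply: (irr v v0) => j; apply/sub_rVP.
have KX w : (w <= X)%MS -> (w <= v)%MS.
  move=> wX; apply: submx_trans wX _.
  rewrite -(geq_leqif (mxrank_leqif_sup vX)) rank_rV v0.
  by move: nf (rank_leq_col X); rewrite /row_full; case: (\rank X) => [|[|[|]]].
by apply: KX; have /submxP[w ->] := vX; rewrite -mulmxA -AX mulmxA submxMl.
Qed.

Lemma irr2_no_hom A B X j : irr2 A -> \tr (A j) != \tr (B j) -> intertwines A B X -> X = 0.
Proof.
move=> irr tAB AX; apply/eqP; apply: contraNT tAB => X0; apply/eqP.
have uX : X \in unitmx by rewrite -row_free_unit (irr2_row_free irr AX).
by rewrite -[LHS](congr1 mxtrace (mulmxK uX (A j))) AX mxtrace_mulC mulmxA mulVmx // mul1mx.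
Qed.

(** Schur's lemma over any field: [X] commutes with a matrix with distinct eigenvalues in [F], so it
    has an eigenvalue [Y 0 0] there, and the singular intertwiner [X - (Y 0 0)%:M] must vanish. *)
Lemma irr2_schur A x y X j : irr2 A -> x != y -> simd (A j) (pair_row x y) ->
  intertwines A A X -> exists a, X = a%:M.
Proof.
move=> irr xy [P uP AE] AX; pose Y := invmx P *m X *m P.
have cY : comm_mx Y (diag_mx (pair_row x y)).
  have := AX j; rewrite AE => e; rewrite /comm_mx /Y.
  have := congr1 (fun Z => invmx P *m Z *m P) e.
  by rewrite !mulmxA mulVmx // mul1mx mulmxKV // -!mulmxA mulmxA => ->.
have Y01 : Y 0 1 = 0.
  have := congr1 (fun Z : 'M_2 => Z 0 1) cY; rewrite mul_mx_diag mul_diag_mx !mxE /=.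
  by move/eqP; rewrite mulrC -subr_eq0 -mulrBl mulf_eq0 subr_eq0 eq_sym (negPf xy) /= => /eqP.
exists (Y 0 0); apply/eqP; rewrite -subr_eq0; apply: contrapT => /negP h.
have hX : intertwines A A (X - (Y 0 0)%:M).
  by move=> i; rewrite mulmxBr mulmxBl AX mul_mx_scalar mul_scalar_mx.
have := irr2_row_free irr hX h; rewrite -kermx_eq0 => /eqP k0.
have : row 0 (invmx P) *m (X - (Y 0 0)%:M) = 0.
  apply/eqP; rewrite mulmxBr subr_eq0 mul_mx_scalar; apply/eqP.
  have -> : row 0 (invmx P) *m X = row 0 Y *m invmx P.
    by rewrite /Y -!row_mul mulmxK.
  have -> : row 0 Y = Y 0 0 *: delta_mx 0 0.
    apply/rowP => l; rewrite [LHS]mxE [RHS]mxE [X in _ * X]mxE; case: l => [[|[|//]]] hl /=.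
      by rewrite mulr1; congr (Y _ _); apply: val_inj.
    by rewrite mulr0 -[RHS]Y01; congr (Y _ _); apply: val_inj.
  by rewrite -scalemxAl -rowE.
move/sub_kermxP; rewrite k0 submx0 => /eqP r0.
have := congr1 (fun r : 'rV_2 => r *m P) r0; rewrite mul0mx -row_mul mulVmx // row1.
by move/rowP/(_ 0)/eqP; rewrite !mxE eqxx oner_eq0.
Qed.

End IrreducibleTriples.

(** * Extensions of triples *)

Section Blocks.
Variable F : fieldType.
Implicit Types a b c d : 'M[F]_2.

Definition blk a b c d : 'M[F]_4 := block_mx a b c d : 'M_(2 + 2).
Definition rblk a b : 'M[F]_(2, 4) := row_mx a b : 'M_(2, 2 + 2).
Definition cblk a b : 'M[F]_(4, 2) := col_mx a b : 'M_(2 + 2, 2).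

Lemma blk_eta (X : 'M[F]_4) : exists a b c d, X = blk a b c d.
Proof. by do 4!eexists; rewrite /blk -[LHS](@submxK _ 2 2 2 2). Qed.

Lemma blk_inj a b c d a' b' c' d' : blk a b c d = blk a' b' c' d' ->
  [/\ a = a', b = b', c = c' & d = d'].
Proof. exact: (@eq_block_mx _ 2 2 2 2). Qed.

Lemma rblk_inj a b a' b' : rblk a b = rblk a' b' -> a = a' /\ b = b'.
Proof. exact: (@eq_row_mx _ 2 2 2). Qed.

Lemma cblk_inj a b a' b' : cblk a b = cblk a' b' -> a = a' /\ b = b'.
Proof. exact: (@eq_col_mx _ 2 2 2). Qed.

Lemma blkM a b c d a' b' c' d' : blk a b c d *m blk a' b' c' d' =
  blk (a *m a' + b *m c') (a *m b' + b *m d') (c *m a' + d *m c') (c *m b' + d *m d').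
Proof. exact: (@mulmx_block _ 2 2 2 2 2 2). Qed.

Lemma rblkM a b a' b' c' d' : rblk a b *m blk a' b' c' d' =
  rblk (a *m a' + b *m c') (a *m b' + b *m d').
Proof. exact: (@mul_row_block _ 2 2 2 2 2). Qed.

Lemma mul_rblk x a b : x *m rblk a b = rblk (x *m a) (x *m b).
Proof. exact: (@mul_mx_row _ 2 2 2 2). Qed.

Lemma blk_cblk a b c d x y : blk a b c d *m cblk x y = cblk (a *m x + b *m y) (c *m x + d *m y).
Proof. exact: (@mul_block_col _ 2 2 2 2 2). Qed.

Lemma mul_cblk a b x : cblk a b *m x = cblk (a *m x) (b *m x).
Proof. exact: (@mul_col_mx _ 2 2 2 2). Qed.

Lemma blk_scalar (x : F) : x%:M = blk x%:M 0 0 x%:M.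
Proof. exact: (@scalar_mx_block _ 2 2). Qed.

Lemma det_blk a c d : \det (blk a 0 c d) = \det a * \det d.
Proof. exact: (@det_lblock _ 2 2). Qed.

Lemma tr_blk a b c d : \tr (blk a b c d) = \tr a + \tr d.
Proof. exact: (@mxtrace_block _ 2 2). Qed.

Lemma unitmx_blk a c d : (blk a 0 c d \in unitmx) = (a \in unitmx) && (d \in unitmx).
Proof. by rewrite !unitmxE det_blk unitrM. Qed.

(** The rank normal form, with the left factor absorbed into [P]. *)
Lemma row_free_rblk (X : 'M[F]_(2, 4)) : row_free X ->
  exists2 P : 'M_4, P \in unitmx & X = rblk 1%:M 0 *m P.
Proof.
move=> fX; pose L := col_ebase X; pose R := row_ebase X.
have XE : X = L *m rblk 1%:M 0 *m R.
  rewrite -{1}[X]mulmx_ebase (eqnP fX) (_ : pid_mx 2 = rblk 1%:M 0) //.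
  exact: (@pid_mx_row _ 2 2).
exists (blk L 0 0 1%:M *m R).
  by rewrite unitmx_mul row_ebase_unit unitmx_blk col_ebase_unit unitmx1.
by rewrite XE mulmxA rblkM mul_rblk !(mul0mx, mulmx0, mulmx1, mul1mx, addr0).
Qed.

Lemma row_full_cblk (X : 'M[F]_(4, 2)) : row_full X ->
  exists2 P : 'M_4, P \in unitmx & P *m X = cblk 0 1%:M.
Proof.
move=> fX; pose L := col_ebase X; pose R := row_ebase X.
have XE : X = L *m cblk 1%:M 0 *m R.
  rewrite -{1}[X]mulmx_ebase (eqnP fX) (_ : pid_mx 2 = cblk 1%:M 0) //.
  exact: (@pid_mx_col _ 2 2).
pose S := blk 0 1%:M (invmx R) 0.
have uS : S \in unitmx.
  have : S *m blk 0 R 1%:M 0 = 1%:M.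
    rewrite blkM !(mul0mx, mulmx0, mulmx1, mul1mx, addr0, add0r).
    by rewrite mulVmx ?row_ebase_unit // blk_scalar.
  by case/mulmx1_unit.
exists (S *m invmx L); first by rewrite unitmx_mul uS unitmx_inv col_ebase_unit.
rewrite XE !mulmxA mulmxKV ?col_ebase_unit // blk_cblk mul_cblk.
by rewrite !(mul0mx, mulmx0, mulmx1, mul1mx, addr0, add0r) mulVmx ?row_ebase_unit.
Qed.

End Blocks.

Section BlockTriples.
Variable F : fieldType.
Implicit Types (A B Y : 'I_3 -> 'M[F]_2) (M N : 'I_3 -> 'M[F]_4).

(** Matrices act on row vectors, so [A] is the subrepresentation and [B] the quotient. *)
Definition tri A Y B : 'I_3 -> 'M[F]_4 := fun j => blk (A j) 0 (Y j) (B j).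

(* This says that the extension tri A Y B splits. *)
Definition coboundary A B Y := exists Z, forall j, Y j = B j *m Z - Z *m A j.

Definition conjugate n (M N : 'I_3 -> 'M[F]_n) :=
  exists2 P, P \in unitmx & intertwines M N P.

Lemma conjugate_sym n (M N : 'I_3 -> 'M[F]_n) : conjugate M N -> conjugate N M.
Proof.
move=> [P uP MN]; exists (invmx P); first by rewrite unitmx_inv.
by move=> j; apply: (can_inj (mulmxK uP)); rewrite mulmxKV // -mulmxA MN mulKmx.
Qed.

Lemma conjugate_trans n (M N K : 'I_3 -> 'M[F]_n) :
  conjugate M N -> conjugate N K -> conjugate M K.
Proof.
move=> [P uP MN] [Q uQ NK]; exists (P *m Q); first by rewrite unitmx_mul uP.
by move=> j; rewrite mulmxA MN -mulmxA NK mulmxA.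
Qed.

Lemma conjugate_simd n (M N : 'I_3 -> 'M[F]_n) j s :
  conjugate M N -> simd (M j) s -> simd (N j) s.
Proof. by move=> /conjugate_sym[P uP MN]; apply: simd_similar uP (esym (MN j)). Qed.

Lemma conjugate_prod3 n (M N : 'I_3 -> 'M[F]_n) :
  conjugate M N -> prod3 M = 1%:M -> prod3 N = 1%:M.
Proof.
move=> [P uP MN] M1; apply: (can_inj (mulKmx uP)).
rewrite mulmx1 /prod3 !mulmxA -MN -(mulmxA _ P) -MN mulmxA -(mulmxA _ P) -MN mulmxA.
by rewrite -/(prod3 M) M1 mul1mx.
Qed.

Lemma tri_intertwiner A B Y Y' X11 X12 X21 X22 :
  intertwines (tri A Y B) (tri A Y' B) (blk X11 X12 X21 X22) ->
  forall j, [/\ A j *m X11 = X11 *m A j + X12 *m Y' j,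
    A j *m X12 = X12 *m B j,
    Y j *m X11 + B j *m X21 = X21 *m A j + X22 *m Y' j &
    Y j *m X12 + B j *m X22 = X22 *m B j].
Proof.
move=> h j; have := h j; rewrite /tri !blkM !(mul0mx, mulmx0, addr0, add0r).
exact: blk_inj.
Qed.

(** The upper right block intertwines [A] and [B], hence vanishes; the diagonal blocks are then
    endomorphisms of [A] and [B], hence scalar. *)
Lemma tri_endo A B Y Y' X :
  (forall Z, intertwines A B Z -> Z = 0) ->
  (forall Z, intertwines A A Z -> exists a, Z = a%:M) ->
  (forall Z, intertwines B B Z -> exists a, Z = a%:M) ->
  intertwines (tri A Y B) (tri A Y' B) X ->
  exists a b Z, X = blk a%:M 0 Z b%:M /\
    forall j, a *: Y j + B j *m Z = Z *m A j + b *: Y' j.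
Proof.
move=> homAB endA endB; have [X11 [X12 [X21 [X22 ->]]]] := blk_eta X.
move=> /tri_intertwiner h.
have X12_0 : X12 = 0 by apply: homAB => j; case: (h j).
have [a Xa] : exists a, X11 = a%:M.
  by apply: endA => j; case: (h j) => -> _ _ _; rewrite X12_0 mul0mx addr0.
have [b Xb] : exists a, X22 = a%:M.
  by apply: endB => j; case: (h j) => _ _ _ <-; rewrite X12_0 mulmx0 add0r.
exists a, b, X21; rewrite X12_0 Xa Xb; split=> // j.
by case: (h j) => _ _; rewrite Xa Xb mul_mx_scalar mul_scalar_mx.
Qed.

Lemma cocycle_tri A B Y : prod3 A = 1%:M -> prod3 B = 1%:M ->
  cocycle B A Y -> prod3 (tri A Y B) = 1%:M.
Proof.
rewrite /prod3 /cocycle /tri => A1 B1 c.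
rewrite !blkM !(mul0mx, mulmx0, addr0, add0r) A1 B1 mulmxDl.
by rewrite c blk_scalar.
Qed.

Lemma tri_coboundary A B Y : coboundary A B Y -> conjugate (tri A Y B) (tri A (fun=> 0) B).
Proof.
move=> [Z YZ]; exists (blk 1%:M 0 (- Z) 1%:M); first by rewrite unitmx_blk !unitmx1.
move=> j; rewrite /tri !blkM !(mul0mx, mulmx0, mulmx1, mul1mx, addr0, add0r) YZ.
by rewrite mulmxN mulNmx addrAC subrr add0r.
Qed.

Lemma tri_swap A B : conjugate (tri A (fun=> 0) B) (tri B (fun=> 0) A).
Proof.
have uS : blk 0 1%:M 1%:M 0 *m blk 0 1%:M 1%:M 0 = 1%:M :> 'M[F]_4.
  by rewrite blkM blk_scalar !(mul0mx, mulmx0, mulmx1, addr0, add0r).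
exists (blk 0 1%:M 1%:M 0); first by case/mulmx1_unit: uS.
by move=> j; rewrite !blkM !(mul0mx, mulmx0, mulmx1, mul1mx, addr0, add0r).
Qed.

Lemma tri_conjugate_quotient A B B' Y :
  conjugate B' B -> exists Y', conjugate (tri A Y B') (tri A Y' B).
Proof.
move=> [R uR RB]; exists (fun j => invmx R *m Y j), (blk 1%:M 0 0 R).
  by rewrite unitmx_blk unitmx1.
by move=> j; rewrite !blkM !(mul0mx, mulmx0, mulmx1, mul1mx, addr0, add0r) mulKVmx // RB.
Qed.

Lemma tri_conjugate_sub A B B' Y :
  conjugate B' B -> exists Y', conjugate (tri B' Y A) (tri B Y' A).
Proof.
move=> [R uR RB]; exists (fun j => Y j *m R), (blk R 0 0 1%:M).
  by rewrite unitmx_blk unitmx1 andbT.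
by move=> j; rewrite !blkM !(mul0mx, mulmx0, mulmx1, mul1mx, addr0, add0r) RB.
Qed.

Lemma tri_of_subrep A M X : row_free X -> intertwines A M X ->
  exists Y B, conjugate M (tri A Y B).
Proof.
move=> fX AX; have [P uP EX] := row_free_rblk fX.
have h j : exists YB : 'M_2 * 'M_2, P *m M j = blk (A j) 0 YB.1 YB.2 *m P.
  have [a [b [c [d NE]]]] := blk_eta (P *m M j *m invmx P).
  exists (c, d); apply/esym; rewrite -[RHS](mulmxKV uP) NE; congr (_ *m _).
  have e : rblk 1%:M 0 *m (P *m M j *m invmx P) = rblk (A j) 0.
    apply: (can_inj (mulmxK uP)); rewrite -(mulmxA (rblk _ _)) mulmxKV // mulmxA -EX -AX EX.
    by rewrite mulmxA mul_rblk mulmx1 mulmx0.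
  move: e; rewrite NE rblkM !mul1mx !mul0mx !addr0.
  by move=> /rblk_inj[-> ->].
have [YB YBE] := choice h; exists (fun j => (YB j).1), (fun j => (YB j).2).
by apply: conjugate_sym; exists P.
Qed.

Lemma tri_of_quotient A M X : row_full X -> intertwines M A X ->
  exists Y B, conjugate M (tri B Y A).
Proof.
move=> fX AX; have [P uP EX] := row_full_cblk fX.
have h j : exists YB : 'M_2 * 'M_2, P *m M j = blk YB.2 0 YB.1 (A j) *m P.
  have [a [b [c [d NE]]]] := blk_eta (P *m M j *m invmx P).
  exists (c, a); apply/esym; rewrite -[RHS](mulmxKV uP) NE; congr (_ *m _).
  have e : P *m M j *m invmx P *m cblk 0 1%:M = cblk 0 (A j).
    by rewrite -EX mulmxA mulmxKV // -mulmxA AX mulmxA EX mul_cblk mul0mx mul1mx.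
  move: e; rewrite NE blk_cblk !mulmx0 !mulmx1 !add0r.
  by move=> /cblk_inj[-> ->].
have [YB YBE] := choice h; exists (fun j => (YB j).1), (fun j => (YB j).2).
by apply: conjugate_sym; exists P.
Qed.

End BlockTriples.

(** * Classification of the solutions *)

Section RankCounts.
Variable F : fieldType.

Lemma rank_ad_pair_same (S T : 'M[F]_2) x y : x != y ->
  simd S (pair_row x y) -> simd T (pair_row x y) -> \rank (ad S T) = 2%N.
Proof.
move=> /negPf xy sS sT; rewrite (rank_ad sS sT) !big_ord_recl !big_ord0 !mxE /=.
by rewrite !eqxx [y == x]eq_sym xy.
Qed.

Lemma rank_ad_pair_pair (S T : 'M[F]_2) x y z : x != y -> x != z -> y != z ->
  simd S (pair_row x y) -> simd T (pair_row x z) -> \rank (ad S T) = 3%N.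
Proof.
move=> /negPf xy /negPf xz /negPf yz sS sT; rewrite (rank_ad sS sT) !big_ord_recl !big_ord0 !mxE /=.
by rewrite !eqxx [y == x]eq_sym xy xz yz.
Qed.

Lemma rank_ad_pair_spectrum (S : 'M[F]_2) (T : 'M[F]_4) x y z : x != y -> x != z -> y != z ->
  simd S (pair_row x y) -> simd T (spectrum x y z) -> \rank (ad S T) = 5%N.
Proof.
move=> /negPf xy /negPf xz /negPf yz sS sT; rewrite (rank_ad sS sT) !big_ord_recl !big_ord0 !mxE /=.
by rewrite !eqxx [y == x]eq_sym xy xz yz.
Qed.

Lemma rank_ad_spectrum (S T : 'M[F]_4) x y z : x != y -> x != z -> y != z ->
  simd S (spectrum x y z) -> simd T (spectrum x y z) -> \rank (ad S T) = 10%N.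
Proof.
move=> /negPf xy /negPf xz /negPf yz sS sT; rewrite (rank_ad sS sT) !big_ord_recl !big_ord0 !mxE /=.
by rewrite !eqxx [y == x]eq_sym [z == x]eq_sym [z == y]eq_sym xy xz yz.
Qed.

Definition row4 (x y z t : F) : 'rV[F]_4 := \row_k [:: x; y; z; t]`_k.

Lemma simd_blk (S T : 'M[F]_2) x y z t :
  simd S (pair_row x y) -> simd T (pair_row z t) -> simd (blk S 0 0 T) (row4 x y z t).
Proof.
move=> /simdP[P uP SP] /simdP[Q uQ TQ]; apply/simdP; exists (blk P 0 0 Q).
  by rewrite unitmx_blk uP.
have -> : row4 x y z t = row_mx (pair_row x y) (pair_row z t) :> 'rV_(2 + 2).
  apply/rowP => k; rewrite !mxE; case: splitP => l ->; rewrite mxE;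
  by case: l => [[|[|//]]].
have -> : diag_mx (row_mx (pair_row x y) (pair_row z t) : 'rV_(2 + 2)) =
    blk (diag_mx (pair_row x y)) 0 0 (diag_mx (pair_row z t)) := @diag_mx_row _ 2 2 _ _.
by rewrite !blkM !(mul0mx, mulmx0, addr0, add0r) SP TQ.
Qed.

Definition swap12 (k : 'I_4) : 'I_4 :=
  nth ord0 [:: ord0; inord 2; inord 1; inord 3] k.

Lemma simd_row4_spectrum (M : 'M[F]_4) x y z :
  simd M (row4 x y x z) -> simd M (spectrum x y z).
Proof.
move=> sM; have fI : injective swap12.
  move=> [[|[|[|[|//]]]] h1] [[|[|[|[|//]]]] h2] /(congr1 val) /=; rewrite ?inordK // => _;
  exact: val_inj.
have -> : spectrum x y z = \row_k (row4 x y x z) 0 (swap12 k).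
  apply/rowP => k; rewrite !mxE /swap12.
  by case: k => [[|[|[|[|//]]]] h] /=; rewrite ?inordK.
exact: simd_perm.
Qed.

Lemma simd_spectrum_swap (M : 'M[F]_4) x y z :
  simd M (spectrum x y z) -> simd M (spectrum x z y).
Proof.
pose f (k : 'I_4) : 'I_4 := nth ord0 [:: ord0; inord 1; inord 3; inord 2] k.
have fI : injective f.
  move=> [[|[|[|[|//]]]] h1] [[|[|[|[|//]]]] h2] /(congr1 val) /=; rewrite ?inordK // => _;
  exact: val_inj.
have -> : spectrum x z y = \row_k (spectrum x y z) 0 (f k).
  apply/rowP => k; rewrite !mxE /f.
  by case: k => [[|[|[|[|//]]]] h] /=; rewrite ?inordK.
exact: simd_perm.
Qed.

End RankCounts.

Section Solutions.
Variables (F : fieldType) (p q r : 'I_3 -> F).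
Hypotheses (pq : forall j, p j != q j) (pr : forall j, p j != r j) (qr : forall j, q j != r j).

Definition is_sol (M : 'I_3 -> 'M[F]_4) :=
  prod3 M = 1%:M /\ forall j, simd (M j) (spectrum (p j) (q j) (r j)).

Lemma conjugate_sol M N : conjugate M N -> is_sol M -> is_sol N.
Proof.
move=> MN [M1 sM]; split; first exact: conjugate_prod3 MN M1.
by move=> j; apply: conjugate_simd MN (sM j).
Qed.

Lemma scott_sol M N : is_sol M -> is_sol N ->
  (exists2 X, X != 0 & intertwines M N X) \/ (exists2 X, X != 0 & intertwines N M X).
Proof.
move=> [M1 sM] [N1 sN]; apply: scott => //.
by rewrite /rank_ad_sum !(rank_ad_spectrum (pq _) (pr _) (qr _) (sM _) (sN _)).
Qed.

Definition pair_triple (p q : 'I_3 -> F) (A : 'I_3 -> 'M[F]_2) :=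
  [/\ prod3 A = 1%:M, forall j, simd (A j) (pair_row (p j) (q j)) & irr2 A].

(** Rigidity: the rank sum is 6 < 8, and a nonzero intertwiner with the irreducible [A] is
    invertible. *)
Lemma pair_triple_conj A A' : pair_triple p q A -> prod3 A' = 1%:M ->
  (forall j, simd (A' j) (pair_row (p j) (q j))) -> conjugate A' A.
Proof.
move=> [A1 sA irr] A'1 sA'.
have : (exists2 X, X != 0 & intertwines A A' X) \/ (exists2 X, X != 0 & intertwines A' A X).
  apply: scott => //.
  by rewrite /rank_ad_sum !(rank_ad_pair_same (pq _) (sA _) (sA' _)).
case=> -[X X0 AX].
  by apply: conjugate_sym; exists X => //; rewrite -row_free_unit (irr2_row_free irr AX).
by exists X => //; rewrite -row_full_unit (irr2_row_full irr AX).
Qed.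

Lemma scott_pair_sol A M : pair_triple p q A -> is_sol M ->
  (exists2 X, row_free X & intertwines A M X) \/ (exists2 X, row_full X & intertwines M A X).
Proof.
move=> [A1 sA irr] [M1 sM].
have : (exists2 X, X != 0 & intertwines A M X) \/ (exists2 X, X != 0 & intertwines M A X).
  apply: scott => //.
  by rewrite /rank_ad_sum !(rank_ad_pair_spectrum (pq _) (pr _) (qr _) (sA _) (sM _)).
case=> -[X X0 AX]; [left|right]; exists X => //.
  exact: irr2_row_free irr AX X0.
exact: irr2_row_full irr AX X0.
Qed.

Lemma pair_triple_endo A X : pair_triple p q A -> intertwines A A X -> exists a, X = a%:M.
Proof. by move=> [_ sA irr]; apply: (irr2_schur (j := i0) irr (pq i0) (sA i0)). Qed.

Lemma pair_triple_hom A B X : pair_triple p q A -> pair_triple p r B ->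
  intertwines A B X -> X = 0.
Proof.
move=> [_ sA irr] [_ sB _]; apply: (irr2_no_hom (j := i0) irr).
rewrite (simd_mxtrace (sA i0)) (simd_mxtrace (sB i0)) !big_ord_recl !big_ord0 !mxE /=.
by rewrite !addr0 (inj_eq (addrI _)).
Qed.

Lemma pair_spectrum_complement (a b : 'M[F]_2) x y z : x != 0 -> y != 0 -> x != z ->
  simd a (pair_row x y) ->
  \tr a + \tr b = x + (x + (y + z)) -> \det a * \det b = x * (x * (y * z)) ->
  simd b (pair_row x z).
Proof.
move=> x0 y0 xz sa; rewrite (simd_mxtrace sa) (simd_det sa) !big_ord_recl !big_ord0 !mxE /=.
rewrite addr0 mulr1 => trb detb; apply: simd_mx2 => //.
  by apply: (addrI (x + y)); rewrite trb; ring.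
by apply: (mulfI (mulf_neq0 x0 y0)); rewrite detb; ring.
Qed.

Lemma spectrum_tr_det (M : 'M[F]_4) x y z : simd M (spectrum x y z) ->
  \tr M = x + (x + (y + z)) /\ \det M = x * (x * (y * z)).
Proof.
move=> sM; rewrite (simd_mxtrace sM) (simd_det sM) !big_ord_recl !big_ord0 !mxE /=.
by rewrite addr0 mulr1.
Qed.

Lemma prod3_tri (A Y B : 'I_3 -> 'M[F]_2) :
  prod3 (tri A Y B) = 1%:M -> prod3 A = 1%:M /\ prod3 B = 1%:M.
Proof.
rewrite /prod3 /tri !blkM !(mul0mx, mulmx0, addr0, add0r) blk_scalar.
by case/blk_inj.
Qed.

(** Scott's lemma makes [A] a subrepresentation or a quotient of [M]; trace and determinant then
    determine the eigenvalues of the other diagonal block, which is conjugate to [B]. *)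
Lemma sol_tri A B M : (forall j, p j != 0) -> (forall j, q j != 0) ->
  pair_triple p q A -> (forall B', prod3 B' = 1%:M ->
    (forall j, simd (B' j) (pair_row (p j) (r j))) -> conjugate B' B) -> is_sol M ->
  (exists Y, conjugate M (tri A Y B)) \/ (exists Y, conjugate M (tri B Y A)).
Proof.
move=> p0 q0 tA Bconj solM; have [_ sA _] := tA.
case: (scott_pair_sol tA solM) => -[X fX AX]; [left|right].
- have [Y [B' MT]] := tri_of_subrep fX AX.
  have [/prod3_tri[_ B'1] sT] := conjugate_sol MT solM.
  have [|Y' TT'] := @tri_conjugate_quotient _ A B B' Y.
    apply: Bconj => // j; have [trT detT] := spectrum_tr_det (sT j).
    apply: pair_spectrum_complement (p0 j) (q0 j) (pr j) (sA j) _ _.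
      by rewrite -trT tr_blk.
    by rewrite -detT det_blk.
  by exists Y'; apply: conjugate_trans MT TT'.
- have [Y [B' MT]] := tri_of_quotient fX AX.
  have [/prod3_tri[B'1 _] sT] := conjugate_sol MT solM.
  have [|Y' TT'] := @tri_conjugate_sub _ A B B' Y.
    apply: Bconj => // j; have [trT detT] := spectrum_tr_det (sT j).
    apply: pair_spectrum_complement (p0 j) (q0 j) (pr j) (sA j) _ _.
      by rewrite addrC -trT tr_blk.
    by rewrite mulrC -detT det_blk.
  by exists Y'; apply: conjugate_trans MT TT'.
Qed.

(** An intertwiner has scalar diagonal blocks [a], [b]. If exactly one is 0, then [Y] or [Y']
    splits; if both are, the remaining block intertwines [B] and [A] and is 0. *)
Lemma tri_nonsplit_unit A B Y Y' X : pair_triple p q A ->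
  (forall Z, intertwines A B Z -> Z = 0) -> (forall Z, intertwines B A Z -> Z = 0) ->
  (forall Z, intertwines B B Z -> exists a, Z = a%:M) ->
  ~ coboundary A B Y -> ~ coboundary A B Y' ->
  intertwines (tri A Y B) (tri A Y' B) X -> X != 0 -> X \in unitmx.
Proof.
move=> tA homAB homBA endB nY nY' XI X0.
have [a [b [Z [XE XY]]]] := tri_endo homAB (fun Z => pair_triple_endo tA) endB XI.
have [a0|a0] := eqVneq a 0.
  have [b0|b0] := eqVneq b 0.
    case/eqP: X0; rewrite XE a0 b0 (homBA Z) => [|j].
      by rewrite -blk_scalar; apply/matrixP => k l; rewrite !mxE mul0rn.
    by have := XY j; rewrite a0 b0 !scale0r add0r addr0.
  case: nY'; exists (b^-1 *: Z) => j; have := XY j; rewrite a0 scale0r add0r => e.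
  by rewrite -scalemxAr -scalemxAl -scalerBr e addrC addKr scalerA mulVf // scale1r.
have [b0|b0] := eqVneq b 0.
  case: nY; exists (- a^-1 *: Z) => j; have := XY j; rewrite b0 scale0r addr0 => e.
  by rewrite -scalemxAr -scalemxAl -scalerBr -e opprD addrCA subrr addr0 scaleNr scalerN opprK scalerA mulVf // scale1r.
by rewrite XE unitmx_blk !unitmxE !det_scalar !unitfE !expf_neq0.
Qed.

(** Distinct diagonal scalars would split the extension, and equal ones leave an intertwiner of [B]
    and [A], which is 0. *)
Lemma tri_nonsplit_centralizer A B Y X : pair_triple p q A ->
  (forall Z, intertwines A B Z -> Z = 0) -> (forall Z, intertwines B A Z -> Z = 0) ->
  (forall Z, intertwines B B Z -> exists a, Z = a%:M) ->
  ~ coboundary A B Y -> intertwines (tri A Y B) (tri A Y B) X -> is_scalar_mx X.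
Proof.
move=> tA homAB homBA endB nY XI.
have [a [b [Z [XE XY]]]] := tri_endo homAB (fun Z => pair_triple_endo tA) endB XI.
have [ab|ab] := eqVneq a b.
  rewrite XE ab (homBA Z) => [|j]; first by rewrite -blk_scalar scalar_mx_is_scalar.
  by have := XY j; rewrite ab addrC => /addIr.
case: nY; exists ((b - a)^-1 *: Z) => j.
rewrite -scalemxAr -scalemxAl -scalerBr.
have -> : B j *m Z - Z *m A j = (b - a) *: Y j.
  have -> : B j *m Z = Z *m A j + b *: Y j - a *: Y j by rewrite -XY addrC addKr.
  by rewrite addrAC [Z *m A j + _]addrC addrK scalerBl.
by rewrite scalerA mulVf ?scale1r // subr_eq0 eq_sym.
Qed.

Lemma nonsplit_sol_exists A B : pair_triple p q A -> pair_triple p r B ->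
  exists2 Y, is_sol (tri A Y B) & ~ coboundary A B Y.
Proof.
move=> [A1 sA _] [B1 sB _].
have rp j : r j != q j by rewrite eq_sym.
have [|X cX nX] := @ext_exists _ 2 2 B A.
  by rewrite /rank_ad_sum !(rank_ad_pair_pair (pr _) (pq _) (rp _) (sB _) (sA _)).
exists (fun j => B j *m X j - X j *m A j) => [|[Z ZE]]; last by apply: nX; exists Z.
split=> [|j]; first exact: cocycle_tri.
apply: simd_row4_spectrum.
(* Each component is conjugate to a direct sum by a unipotent matrix depending on [j]; being
   nonsplit only forbids a choice common to all [j]. *)
apply: (simd_similar (P := blk 1%:M 0 (- X j) 1%:M) (M := blk (A j) 0 0 (B j))).
- by rewrite unitmx_blk !unitmx1.
- rewrite /tri !blkM !(mul0mx, mulmx0, mulmx1, mul1mx, addr0, add0r).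
  by rewrite mulmxN mulNmx addrAC subrr add0r.
- exact: simd_blk.
Qed.

End Solutions.

Section SolutionOrbits.
Variables (F : fieldType) (p q r : 'I_3 -> F).
Hypotheses (pq : forall j, p j != q j) (pr : forall j, p j != r j) (qr : forall j, q j != r j).

Lemma nonsplit_sol_conj A B Y Y' : pair_triple p q A -> pair_triple p r B ->
  is_sol p q r (tri A Y B) -> is_sol p q r (tri A Y' B) ->
  ~ coboundary A B Y -> ~ coboundary A B Y' -> conjugate (tri A Y B) (tri A Y' B).
Proof.
move=> tA tB sY sY' nY nY'; have rq j : r j != q j by rewrite eq_sym.
have homAB Z := pair_triple_hom qr tA tB (X := Z).
have homBA Z := pair_triple_hom rq tB tA (X := Z).
have endB Z := pair_triple_endo pr tB (X := Z).
case: (scott_sol pq pr qr sY sY') => -[X X0 XI]; last apply: conjugate_sym.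
  by exists X => //; apply: (tri_nonsplit_unit pq tA homAB homBA endB nY nY' XI X0).
by exists X => //; apply: (tri_nonsplit_unit pq tA homAB homBA endB nY' nY XI X0).
Qed.

Lemma is_sol_swap M : is_sol p q r M -> is_sol p r q M.
Proof. by move=> [M1 sM]; split=> // j; apply: simd_spectrum_swap. Qed.

Lemma pair_triple_exists : p i0 * q i0 * (p i1 * q i1) * (p i2 * q i2) = 1 ->
  (forall e, (forall j, e j = p j \/ e j = q j) -> e i0 * e i1 * e i2 <> 1) ->
  exists A, pair_triple p q A.
Proof.
move=> e nr; have [A [A1 sA]] := rank2_triple_exists pq e.
by exists A; split=> //; apply: irr2_nonresonant A1 sA nr.
Qed.

Lemma split_sol A B : pair_triple p q A -> pair_triple p r B ->
  is_sol p q r (tri A (fun=> 0) B).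
Proof.
move=> [A1 sA _] [B1 sB _]; split=> [|j].
  by apply: cocycle_tri; rewrite /cocycle ?mul0mx ?mulmx0 ?mul0mx ?addr0.
by apply: simd_row4_spectrum; apply: simd_blk.
Qed.

End SolutionOrbits.

Lemma sol_orbits (F : fieldType) (p q r : 'I_3 -> F) :
  (forall j, p j != q j) -> (forall j, p j != r j) -> (forall j, q j != r j) ->
  (forall j, p j != 0) -> (forall j, q j != 0) ->
  p i0 * q i0 * (p i1 * q i1) * (p i2 * q i2) = 1 ->
  p i0 * r i0 * (p i1 * r i1) * (p i2 * r i2) = 1 ->
  (forall e, (forall j, e j = p j \/ e j = q j) -> e i0 * e i1 * e i2 <> 1) ->
  (forall e, (forall j, e j = p j \/ e j = r j) -> e i0 * e i1 * e i2 <> 1) ->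
  exists T : 'I_3 -> 'I_3 -> 'M[F]_4,
    [/\ forall M, is_sol p q r M <-> exists i, conjugate M (T i),
        forall X, intertwines (T i1) (T i1) X -> is_scalar_mx X &
        exists2 X, intertwines (T i0) (T i0) X & ~ is_scalar_mx X].
Proof.
move=> pq pr qr p0 q0 e1 e2 nr1 nr2; have rq j : r j != q j by rewrite eq_sym.
have [A tA] := pair_triple_exists pq e1 nr1; have [B tB] := pair_triple_exists pr e2 nr2.
have [Y1 sY1 nY1] := nonsplit_sol_exists pq pr qr tA tB.
have [Y2 /is_sol_swap sY2 nY2] := nonsplit_sol_exists pr pq rq tB tA.
(* Representatives of the direct sum, of the nonsplit extensions with subrepresentation [A] and of
   those with subrepresentation [B]. *)
pose T (i : 'I_3) := if i == i0 then tri A (fun=> 0) B else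
  if i == i1 then tri A Y1 B else tri B Y2 A.
have sT i : is_sol p q r (T i).
  move: i; apply: forall_ord3; rewrite /T //=; exact: split_sol.
have Tsol M i : conjugate M (T i) -> is_sol p q r M.
  by move=> /conjugate_sym MT; apply: conjugate_sol MT (sT i).
exists T; split.
- move=> M; split=> [sM|]; last by case=> i; apply: Tsol.
  have Bconj B' := pair_triple_conj pr tB (A' := B').
  case: (sol_tri pq pr qr p0 q0 tA Bconj sM) => -[Y MY].
    have sY := conjugate_sol MY sM.
    have [cY|nY] := pselect (coboundary A B Y).
      by exists i0; apply: conjugate_trans MY (tri_coboundary cY).
    by exists i1; apply: conjugate_trans MY _; apply: (nonsplit_sol_conj pq pr qr).
  have sY := conjugate_sol MY sM.
  have [cY|nY] := pselect (coboundary B A Y).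
    exists i0; apply: conjugate_trans MY _; apply: conjugate_trans (tri_coboundary cY) _.
    exact: tri_swap.
  exists i2; apply: conjugate_trans MY _.
  by apply: (nonsplit_sol_conj pr pq rq) => //; apply: is_sol_swap.
- move=> X; have homAB Z := pair_triple_hom qr tA tB (X := Z).
  have homBA Z := pair_triple_hom rq tB tA (X := Z).
  have endB Z := pair_triple_endo pr tB (X := Z).
  exact: (tri_nonsplit_centralizer pq tA homAB homBA endB nY1).
(* The projection onto one summand commutes with the direct sum. *)
- exists (blk 1%:M 0 0 0) => [j|/is_scalar_mxP[x]].
    by rewrite /T /tri /= !blkM !(mul0mx, mulmx0, mulmx1, mul1mx, addr0, add0r).
  rewrite blk_scalar => /blk_inj[e _ _ e']; have := e.
  have x0 : x = 0 by move/matrixP/(_ 0 0): e'; rewrite !mxE.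
  by rewrite x0 => /matrixP/(_ 0 0)/eqP; rewrite !mxE oner_eq0.
Qed.

(** * From families indexed by ['I_3] to tuples, and the conclusion *)

Section Tuples.
Variable F : numFieldType.

Definition entry (T : 'M[F]_4 * 'M[F]_4 * 'M[F]_4) : 'I_3 -> 'M[F]_4 :=
  fun j => if j == i0 then T.1.1 else if j == i1 then T.1.2 else T.2.

Definition pack (M : 'I_3 -> 'M[F]_4) := (M i0, M i1, M i2).

Lemma entry_pack M j : entry (pack M) j = M j.
Proof. by move: j; apply: forall_ord3. Qed.

Lemma orbit_of_conjugate M x :
  orbit_of (triple_map (pack M)) x <-> conjugate (entry x) M.
Proof.
case: x => -[x1 x2] x3; split=> [[P uP [-> -> ->]]|[P uP h]].
  by exists P => //; apply: forall_ord3; rewrite /entry /= /conj_map mulmxKV.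
exists P => //; rewrite /triple_map /=.
by congr (_, _, _); apply/mx_conjP => //; [exact: (h i0)|exact: (h i1)|exact: (h i2)].
Qed.

Lemma solutions_is_sol (a b c f g h u v w : F) T :
  let p j := if j == i0 then a else if j == i1 then f else u in
  let q j := if j == i0 then b else if j == i1 then g else v in
  let r j := if j == i0 then c else if j == i1 then h else w in
  solutions (conj_class (spectrum a b c)) (conj_class (spectrum f g h))
    (conj_class (spectrum u v w)) T <-> is_sol p q r (entry T).
Proof.
move=> p q r; split=> [[h1 h2 h3 e]|[e s]].
  by split=> //; apply: forall_ord3.
by split=> //; [exact: (s i0)|exact: (s i1)|exact: (s i2)].
Qed.

Lemma trivial_centralizer_pack M :
  trivial_centralizer (pack M) <-> forall X, intertwines M M X -> is_scalar_mx X.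
Proof.
split=> h X.
  by move=> XM; apply: h; split; rewrite /comm_mx /= XM.
by case=> h1 h2 h3; apply: h; apply: forall_ord3.
Qed.

End Tuples.

Lemma nongenericity_singletons (F : fieldType) (s1 s2 s3 : 'rV[F]_4) k1 k2 k3 :
  s1 0 k1 * s2 0 k2 * s3 0 k3 = 1 ->
  nongenericity s1 s2 s3 [set k1]%SET [set k2]%SET [set k3]%SET.
Proof. by move=> e; exists 1%N; split; rewrite ?cards1 // !big_set1. Qed.

Theorem mainTheorem13 (R : realType) (a b c f g h u v w : R[i])
  (abc_distinct : uniq [:: a; b; c]) (abc_nonzero : 0 \notin [:: a; b; c])
  (fgh_distinct : uniq [:: f; g; h]) (fgh_nonzero : 0 \notin [:: f; g; h])
  (uvw_distinct : uniq [:: u; v; w]) (uvw_nonzero : 0 \notin [:: u; v; w])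
  (prod_eq1 : a ^+ 2 * b * c * (f ^+ 2 * g * h) * (u ^+ 2 * v * w) = 1)
  (relation : a * b * f * g * u * v = 1)
  (only_relation : forall A1 A2 A3 : {set 'I_4},
     nongenericity (spectrum a b c) (spectrum f g h) (spectrum u v w) A1 A2 A3 ->
     [/\ perm_eq (selected (spectrum a b c) A1) [:: a; b],
         perm_eq (selected (spectrum f g h) A2) [:: f; g] &
         perm_eq (selected (spectrum u v w) A3) [:: u; v]] \/
     [/\ perm_eq (selected (spectrum a b c) A1) [:: a; c],
         perm_eq (selected (spectrum f g h) A2) [:: f; h] &
         perm_eq (selected (spectrum u v w) A3) [:: u; w]]) :
  let C1 := conj_class (spectrum a b c) in
  let C2 := conj_class (spectrum f g h) in
  let C3 := conj_class (spectrum u v w) in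
  let V := solutions C1 C2 C3 in
  [/\ exists2 T, V T & trivial_centralizer T,
      exists2 T, V T & ~ trivial_centralizer T &
      exists d1 d2 d3 : nat,
        [/\ has_dim C1 d1, has_dim C2 d2, has_dim C3 d3,
            (d1 + d2 + d3 - 4 ^ 2 + 1 = 15)%N &
            has_dim V (d1 + d2 + d3 - 4 ^ 2 + 1)%N]].
Proof.
move=> C1 C2 C3 V.
pose p (j : 'I_3) := if j == i0 then a else if j == i1 then f else u.
pose q (j : 'I_3) := if j == i0 then b else if j == i1 then g else v.
pose r (j : 'I_3) := if j == i0 then c else if j == i1 then h else w.
have VE T : V T <-> is_sol p q r (entry T) by exact: solutions_is_sol.
have nr k1 k2 k3 :
    spectrum a b c 0 k1 * spectrum f g h 0 k2 * spectrum u v w 0 k3 <> 1.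
  move=> /nongenericity_singletons/only_relation[] [/perm_size + _ _];
  by rewrite /selected size_map -cardE cards1.
(* The complementary relation: the product of all eigenvalues divided by the given relation. *)
have relation' : a * c * f * h * u * w = 1.
  by rewrite -[RHS]prod_eq1 -[LHS]mul1r -{1}relation; ring.
have [abp acp bcp] : [/\ a != b, a != c & b != c].
  by move: abc_distinct; rewrite /= !inE negb_or andbT => /andP[/andP[-> ->] ->].
have [fgp fhp ghp] : [/\ f != g, f != h & g != h].
  by move: fgh_distinct; rewrite /= !inE negb_or andbT => /andP[/andP[-> ->] ->].
have [uvp uwp vwp] : [/\ u != v, u != w & v != w].
  by move: uvw_distinct; rewrite /= !inE negb_or andbT => /andP[/andP[-> ->] ->].
move: abc_nonzero fgh_nonzero uvw_nonzero; rewrite !inE !negb_or ![0 == _]eq_sym.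
move=> /and3P[a0 b0 c0] /and3P[f0 g0 h0] /and3P[u0 v0 w0].
pose k2 : 'I_4 := inord 2; pose k3 : 'I_4 := inord 3.
have spE x y z : [/\ spectrum x y z 0 ord0 = x, spectrum x y z 0 k2 = y & spectrum x y z 0 k3 = z :> R[i]].
  by rewrite !mxE /k2 /k3 !inordK.
have nrE x y z : (exists k, spectrum a b c 0 k = x) -> (exists k, spectrum f g h 0 k = y) ->
   (exists k, spectrum u v w 0 k = z) -> x * y * z <> 1.
  by move=> [l1 <-] [l2 <-] [l3 <-].
have [||||||||| T [TE Ttriv [X XT Xns]]] := @sol_orbits _ p q r.
- exact: forall_ord3.
- exact: forall_ord3.
- exact: forall_ord3.
- exact: forall_ord3.
- exact: forall_ord3.
- by rewrite /p /q /= -[RHS]relation; ring.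
- by rewrite /p /r /= -[RHS]relation'; ring.
- move=> e he; apply: nrE.
  + by case: (spE a b c) => x y z; case: (he i0) => ->; [exists ord0|exists k2].
  + by case: (spE f g h) => x y z; case: (he i1) => ->; [exists ord0|exists k2].
  + by case: (spE u v w) => x y z; case: (he i2) => ->; [exists ord0|exists k2].
- move=> e he; apply: nrE.
  + by case: (spE a b c) => x y z; case: (he i0) => ->; [exists ord0|exists k3].
  + by case: (spE f g h) => x y z; case: (he i1) => ->; [exists ord0|exists k3].
  + by case: (spE u v w) => x y z; case: (he i2) => ->; [exists ord0|exists k3].
have VT x : V x <-> exists i, orbit_of (triple_map (pack (T i))) x.
  by rewrite VE TE; split=> -[i xi]; exists i; apply/orbit_of_conjugate.
have Tsol i : V (pack (T i)).
  apply/VT; exists i; apply/orbit_of_conjugate; exists 1%:M; first exact: unitmx1.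
  by move=> j; rewrite entry_pack mulmx1 mul1mx.
have tc1 : trivial_centralizer (pack (T i1)) by apply/trivial_centralizer_pack.
split.
- by exists (pack (T i1)).
- by exists (pack (T i0)) => // /trivial_centralizer_pack/(_ X XT).
(* Each class has dimension 10, and 30 - 16 + 1 = 15. *)
exists 10%N, 10%N, 10%N; split=> //; try exact: has_dim_conj_class.
by apply: (has_dim_triples VT); exists i1.
Qed.
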